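(* For every even integer $q\ge 2$, $N(4,q,1)=\dfrac{q^2(q+2)}{4}$.
   Context: $B_q=\{0,\dots,q-1\}$ and $B_q^4$ is the set of words of length 4 over $B_q$. $N(4,q,1)$ is the maximum cardinality of a code $C\subseteq B_q^4$ capable of correcting single deletions, i.e. such that the sets $\lfloor x\rfloor_1$ ($x\in C$) of words obtained from $x$ by deleting one letter are pairwise disjoint (equivalently, the minimum deletion–insertion distance, i.e. minimum number of letter deletions and insertions transforming one codeword into another, between distinct codewords exceeds 2). *)

(* Defs.v *)
From mathcomp Require Import all_boot.
Set Implicit Arguments. Unset Strict Implicit. Unset Printing Implicit Defensive.

(* The list of words obtained from s by deleting exactly one letter
   (the set floor(x)_1, with possible repetitions in the list). *)
Definition del1 (T : eqType) (s : seq T) : seq (seq T) :=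
  [seq take i s ++ drop i.+1 s | i <- iota 0 (size s)].

Definition single_del_code (n q : nat) (C : {set n.-tuple 'I_q}) : bool :=
  [forall x in C, forall y in C,
     (x != y) ==> ~~ has (fun w => w \in del1 (val y)) (del1 (val x))].

Definition N1 (n q : nat) : nat :=
  \max_(C : {set n.-tuple 'I_q} | single_del_code C) #|C|.

(* Main.v *)
Require Import Defs.
From mathcomp Require Import all_boot all_algebra zify ring.
(** Upper bound: give a triple weight 2 for each of its two adjacent equalities, weight 1
    if its letters are distinct, and weight 0 if it has the form [aba] with [a != b].  The
    subwords of a codeword have total weight at least 4, or at least 2 for the words [abca]
    with [a], [b], [c] distinct; as [q] is even, a code contains at most [(q - 2) / 2] of the
    latter for each [a], and the total weight of all triples gives the bound.

    Lower bound: fix an involution [pi] of the letters without fixed points and take all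
    words [aacc] together with a system of words whose deletion balls partition the triples
    [abc] with [a != b != c] other than [a (pi a) a]; counting shows that this code is
    optimal.  Systems on [2 n] letters, possibly with a hole (four letters whose triples stay
    uncovered), are built recursively from two or three groups of letters and a common set
    of 0, 2 or 4 extra letters: [n] is obtained as [2 k], [3 k], [3 k + 1] or [3 k + 2].
    Each group is filled with a smaller system.  A triple with two letters [x], [x'] in one
    group and one in another is covered through a 1-factorization of the complete graph on
    [Z / 2 k], or, for the differences [x' - x] produced by a partial matching [tau] of
    [Z / 2 k], together with the triples that meet three groups and have their sum in the
    domain of [tau].  The other triples meeting three groups are completed by an extra
    letter determined by the sum.  The cases [n = 1, 5, 9] are treated directly. *)

Set Implicit Arguments. Unset Strict Implicit. Unset Printing Implicit Defensive.
Import GRing.Theory.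

(** The words [abca] with given [a] use the [q - 1] triples [axa] two at a time, and [q - 1] is odd:
    [a (pi a) a], of weight 0, is the one left over. Holes are needed because extra letters belong
    to every group. A single pair of letters contains no triple to cover, but the triples inside
    four extra letters would be covered three times. Hence the induction carries systems with a hole
    of two pairs, and the recursions are arranged to produce such a hole again. Each of the two
    cyclic directions of the groups has its matching, so there are as many differences as points in
    the domain. The differences left over must form, with 0 put aside, a union of colour classes of
    the 1-factorization that contains the class serving as [pi]; this decides which 1-factorization
    is taken. Equally many sums are left over. They are attached to extra letters or, if there are
    none, are 0 and [k], and are then treated together with the triples on two orbits of [pi]. *)

Section Words.
Variable L : eqType.
Implicit Types (u v : L * L * L) (w : L * L * L * L).

(** Nested pairs instead of tuples, so that words and triples can be taken apart by pattern
    matching; tuples reappear only where codes are mentioned. *)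
Definition subwords w : seq (L * L * L) :=
  let: (a, b, c, d) := w in [:: (b, c, d); (a, c, d); (a, b, d); (a, b, c)].

End Words.

Definition seq_of_triple (L : eqType) (u : L * L * L) : seq L :=
  let: (a, b, c) := u in [:: a; b; c].

Definition tuple_of_word (L : eqType) (w : L * L * L * L) : 4.-tuple L :=
  let: (a, b, c, d) := w in [tuple a; b; c; d].

Definition word_of_tuple (L : eqType) (t : 4.-tuple L) : L * L * L * L :=
  (tnth t (@Ordinal 4 0 isT), tnth t (@Ordinal 4 1 isT),
   tnth t (@Ordinal 4 2 isT), tnth t (@Ordinal 4 3 isT)).

Arguments word_of_tuple : simpl never.

Lemma tuple_of_wordK (L : eqType) : cancel (@tuple_of_word L) (@word_of_tuple L).
Proof. by case=> [[[a b] c] d]. Qed.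

Lemma word_of_tupleK (L : eqType) : cancel (@word_of_tuple L) (@tuple_of_word L).
Proof.
move=> t; case/tupleP: t => a t; case/tupleP: t => b t; case/tupleP: t => c t.
by case/tupleP: t => d t; rewrite (tuple0 t); apply/val_inj.
Qed.

Lemma seq_of_triple_inj (L : eqType) : injective (@seq_of_triple L).
Proof. by case=> [[a b] c] [[a' b'] c'] [-> -> ->]. Qed.

Lemma del1_word (L : eqType) (w : L * L * L * L) :
  del1 (tuple_of_word w) = map (@seq_of_triple L) (subwords w).
Proof. by case: w => [[[a b] c] d]. Qed.

Lemma del_codeP (q : nat) (C : {set 4.-tuple 'I_q}) :
  reflect (forall w w' u, tuple_of_word w \in C -> tuple_of_word w' \in C ->
             u \in subwords w -> u \in subwords w' -> w = w')
          (single_del_code C).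
Proof.
apply: (iffP idP) => [codeC w w' u Cw Cw' uw uw' | inj].
  apply/eqP; apply: contraT => ne_ww'.
  have /forallP/(_ (tuple_of_word w))/implyP/(_ Cw) := codeC.
  move/forallP/(_ (tuple_of_word w'))/implyP/(_ Cw')/implyP.
  rewrite (can_eq (@tuple_of_wordK _)) => /(_ ne_ww')/negP[].
  apply/hasP; exists (seq_of_triple u); rewrite !del1_word.
    exact: map_f.
  exact: map_f.
apply/forallP => x; apply/implyP => Cx; apply/forallP => y; apply/implyP => Cy.
apply/implyP; apply: contraNN => /hasP[s].
rewrite -(word_of_tupleK x) -(word_of_tupleK y) !del1_word.
move=> /mapP[u ux ->]; rewrite (mem_map (@seq_of_triple_inj _)) => uy.
apply/eqP; congr tuple_of_word.
by apply: inj ux uy; rewrite word_of_tupleK.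
Qed.

(** * Upper bound: weights of triples *)

Section UpperBound.
Variable q : nat.
Implicit Types (a b c d : 'I_q).

Definition triple_weight (u : 'I_q * 'I_q * 'I_q) : nat :=
  let: (a, b, c) := u in
  2 * (a == b) + 2 * (b == c) + [&& a != b, b != c & a != c].

Lemma subword_weight (w : 'I_q * 'I_q * 'I_q * 'I_q) :
  4 <= \sum_(u | u \in subwords w) triple_weight u
     + 2 * [&& w.1.1.1 == w.2, w.1.1.1 != w.1.1.2, w.1.2 != w.2
             & w.1.1.2 != w.1.2].
Proof.
(* The ball is a set: a subword that arises from several deletions is counted once. What follows is
   a check of all equality patterns of four letters. *)
rewrite (eq_bigl (fun u => u \in undup (subwords w))) => [|u]; last first.
  by rewrite mem_undup.
rewrite -big_uniq ?undup_uniq //=.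
case: w => [[[a b] c] d] /=; rewrite !inE !xpair_eqE.
repeat match goal with |- context [?x == ?y] =>
  is_var x; is_var y; case: (eqVneq x y) => [?|?]; [subst|];
  rewrite ?eqxx ?andbT ?andbF ?orbT ?orbF /= end;
rewrite ?big_cons ?big_nil /= ?eqxx /=;
repeat match goal with |- context [?x == ?y] =>
  is_var x; is_var y; case: (eqVneq x y) => [?|?]; [subst|]; rewrite /= end;
try match goal with H : is_true (?x != ?x) |- _ => by rewrite eqxx in H end;
by [].
Qed.

Lemma sum_triple_weight :
  \sum_u triple_weight u = q ^ 3 + q ^ 2 + 2 * q.
Proof.
have sum1 (a : 'I_q) : \sum_(b : 'I_q) (a == b) = 1.
  by rewrite (bigD1 a) //= eqxx big1 ?addn0 // => b /negPf; rewrite eq_sym => ->.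
have sumN (a : 'I_q) : \sum_(b : 'I_q) (a != b) = q - 1.
  rewrite -[q in RHS]card_ord -sum1_card -[X in _ = _ - X](sum1 a) -sumnB //.
    by apply: eq_bigr => b _; case: eqP.
  by move=> b _; case: eqP.
have sum2 (a b : 'I_q) :
    \sum_(c : 'I_q) [&& a != b, b != c & a != c] = (a != b) * (q - 2).
  have [->|ab] := eqVneq a b; first by rewrite big1.
  rewrite (eq_bigr (fun c => (b != c) - (a == c))) => [|c _]; last first.
    by case: (eqVneq a c) => [<-|_]; rewrite ?andbF ?andbT /= ?subn0 // eq_sym ab.
  rewrite sumnB => [|c _]; last by case: eqP => // <-; rewrite eq_sym ab.
  by rewrite sumN sum1 mul1n; lia.
have sum3 (a b : 'I_q) :
    \sum_c triple_weight (a, b, c) = (2 * (a == b) * q + 2) + (a != b) * (q - 2).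
  rewrite /triple_weight !big_split /= sum2 sum_nat_const card_ord.
  rewrite ?big_split /= ?sum1 ?sum_nat_const ?card_ord.
  lia.
have sum4 (a : 'I_q) : \sum_b \sum_c triple_weight (a, b, c) = 4 * q + (q - 1) * (q - 2).
  under eq_bigr do rewrite sum3.
  rewrite !big_split /= -!big_distrl /= ?big_split /= ?sum1 ?sumN ?sum_nat_const ?card_ord.
  lia.
rewrite (eq_bigr (fun p => triple_weight (p.1, p.2))); last by case.
rewrite -(pair_bigA _ (fun p c => triple_weight (p, c))).
rewrite (eq_bigr (fun p => \sum_c triple_weight (p.1, p.2, c))); last by case.
rewrite -(pair_bigA _ (fun a b => \sum_c triple_weight (a, b, c))).
rewrite (eq_bigr (fun=> 4 * q + (q - 1) * (q - 2))) // sum_nat_const card_ord.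
case: q => [|[|n]] //; nia.
Qed.

Variable C : {set 4.-tuple 'I_q}.
Hypothesis codeC : single_del_code C.

Definition returning a : {set 'I_q * 'I_q} :=
  [set p | [&& tuple_of_word (a, p.1, p.2, a) \in C, p.1 != a, p.2 != a & p.1 != p.2]].

(** The ball of [abca] contains [aba] and [aca], so the middle letters of all these words are
    pairwise distinct, and they differ from [a]. *)
Lemma card_returning a : #|returning a| * 2 <= q - 1.
Proof.
pose f (pb : ('I_q * 'I_q) * bool) := if pb.2 then pb.1.1 else pb.1.2.
have inC p : p \in returning a -> tuple_of_word (a, p.1, p.2, a) \in C.
  by rewrite inE => /and4P[].
have inj : {in setX (returning a) [set: bool] &, injective f}.
  move=> [p b] [p' b'] /setXP[/= Rp _] /setXP[/= Rp' _].
  rewrite /f /= => e.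
  have E : p = p'.
    have mem (r : 'I_q * 'I_q) s :
      (a, if s then r.1 else r.2, a) \in subwords (a, r.1, r.2, a).
      by rewrite !inE; case: s; rewrite eqxx ?orbT.
    have m' := mem p' b'; rewrite -e in m'.
    have [] := del_codeP C codeC _ _ _ (inC _ Rp) (inC _ Rp') (mem p b) m'.
    by case: (p) (p') => [? ?] [? ?] /= -> ->.
  move: Rp e; rewrite -E inE => /and4P[_ _ _ ne].
  by case: b b' => [] [] // e; rewrite e eqxx in ne.
have -> : #|returning a| * 2 = #|f @: setX (returning a) [set: bool]|.
  by rewrite card_in_imset // cardsX cardsT card_bool.
have -> : q - 1 = #|[set~ a]| by rewrite cardsC1 card_ord; lia.
apply/subset_leq_card/subsetP => x /imsetP[[p b] /setXP[/=]].
by rewrite !inE => /and4P[_ p1 p2 _] _ ->; rewrite /f /=; case: b.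
Qed.

Lemma del_code_bound : ~~ odd q -> 4 * #|C| <= q ^ 2 * (q + 2).
Proof.
move=> even_q.
pose ret (t : 4.-tuple 'I_q) := let: (a, b, c, d) := word_of_tuple t in
  [&& a == d, a != b, c != d & b != c].
have le1 : 4 * #|C| <= \sum_(t in C)
    (\sum_(u | u \in subwords (word_of_tuple t)) triple_weight u + 2 * ret t).
  rewrite mulnC -sum_nat_const; apply: leq_sum => t _.
  have := subword_weight (word_of_tuple t); rewrite /ret.
  by case: (word_of_tuple t) => [[[a b] c] d].
apply: (leq_trans le1); rewrite big_split /=.
have le2 : \sum_(t in C) \sum_(u | u \in subwords (word_of_tuple t)) triple_weight u
    <= \sum_u triple_weight u.
  (* Double counting: a triple lies in the ball of at most one codeword. *)
  rewrite (exchange_big_dep predT) //=; apply: leq_sum => u _.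
  rewrite sum_nat_const -[X in _ <= X]mul1n leq_mul2r; apply/orP; right.
  apply/card_le1_eqP => t t' /andP[Ct ut] /andP[Ct' ut'].
  apply: (can_inj (@word_of_tupleK _)).
  rewrite -(word_of_tupleK t) in Ct; rewrite -(word_of_tupleK t') in Ct'.
  by have -> := elimT (del_codeP C) codeC _ _ u Ct Ct' ut ut'.
have le3 : \sum_(t in C) 2 * ret t <= q * (q - 2).
  rewrite -big_distrr /= -big_mkcondr /= sum1_card.
  have -> : #|[pred t in C | ret t]| = \sum_a #|returning a|.
    rewrite -sum1_card (partition_big (fun t => (word_of_tuple t).2) predT) //=.
    apply: eq_bigr => a _; rewrite sum1_card.
    pose f (p : 'I_q * 'I_q) := tuple_of_word (a, p.1, p.2, a).
    rewrite -(card_imset (f := f)) => [|[b c] [b' c']]; last first.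
      by move/(can_inj (@tuple_of_wordK _)) => [-> ->].
    apply: eq_card => t; rewrite unfold_in /= unfold_in /=.
    have := word_of_tupleK t; rewrite /ret.
    case: (word_of_tuple t) => [[[a' b] c] d] /= <-.
    apply/andP/imsetP => [[/andP[Ct /and4P[/eqP e ab cd bc]] /eqP e']|[[b' c']]].
      by subst; exists (b, c); rewrite // inE Ct /= eq_sym ab cd bc.
    rewrite inE /= => /and4P[Ct ba ca bc] e.
    have [-> -> -> ->] : (a', b, c, d) = (a, b', c', a).
      exact: (can_inj (@tuple_of_wordK _)).
    by rewrite Ct !eqxx ca bc eq_sym ba.
  rewrite big_distrr /= -[q in q * _]card_ord -sum_nat_const; apply: leq_sum => a _.
  (* The parity of [q] enters here: twice a number bounded by the odd number [q - 1] is at most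
     [q - 2]. *)
  rewrite mulnC -[q in _ <= q - 2]even_halfK //.
  have := card_returning a; rewrite -[q in _ <= q - 1]even_halfK //.
  by move: #|returning a| q./2 => r k; lia.
apply: (leq_trans (leq_add le2 le3)); rewrite sum_triple_weight.
by case: q even_q => [|[|n]] // _; nia.
Qed.
End UpperBound.

(** * Perfect coverings of sets of triples *)

Section Cover.
Variable L : eqType.
Implicit Types (P Q : pred (L * L * L)) (u v : L * L * L) (w : L * L * L * L).

(* A system of 4-words whose deletion balls partition the triples of [P],
   presented by its decoder [dec]. *)
Definition cov P := exists dec : L * L * L -> L * L * L * L, forall u, P u ->
  u \in subwords (dec u) /\
  forall v, v \in subwords (dec u) -> P v /\ dec v = dec u.

(** The form used for explicit families: the check runs over words and their four subwords, and a
    word recovered from each of its subwords shares none of them with another word. *)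
Lemma cov_family P (F : L * L * L * L -> Prop) dec :
    (forall w v, F w -> v \in subwords w -> P v /\ dec v = w) ->
    (forall u, P u -> exists2 w, F w & u \in subwords w) ->
  cov P.
Proof.
move=> FP PF; exists dec => u /PF[w Fw uw].
by have [_ e] := FP _ _ Fw uw; rewrite e; split=> // v /(FP _ _ Fw).
Qed.

Lemma eq_cov P Q : P =1 Q -> cov P -> cov Q.
Proof.
move=> PQ [dec decP]; exists dec => u; rewrite -PQ => /decP[uw closed].
by split=> // v /closed[]; rewrite PQ.
Qed.

(** The parts of a finite partition may be covered independently, since the ball of a word used for
    a triple stays in the part of this triple. *)
Lemma cov_sel P (K : finType) (sel : L * L * L -> K) :
  (forall k, cov (fun u => P u && (sel u == k))) -> cov P.
Proof.
move=> /fin_all_exists[dec decP]; exists (fun u => dec (sel u) u) => u Pu.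
have [|uw closed] := decP (sel u) u; first by rewrite Pu /=.
by split=> // v /closed[/andP[Pv /eqP->]].
Qed.

(** The word [(u, u.2)] is a dummy value; later decoders also return it outside their domain. *)
Lemma cov0 P : (forall u, ~~ P u) -> cov P.
Proof.
by move=> P0; exists (fun u => (u, u.2)) => u Pu; case/negP: (P0 u).
Qed.

End Cover.

Definition triple_map (L L' : Type) (f : L -> L') (u : L * L * L) :=
  let: (a, b, c) := u in (f a, f b, f c).
Definition word_map (L L' : Type) (f : L -> L') (w : L * L * L * L) :=
  let: (a, b, c, d) := w in (f a, f b, f c, f d).

Lemma subwords_map (L L' : eqType) (f : L -> L') w :
  subwords (word_map f w) = map (triple_map f) (subwords w).
Proof. by case: w => [[[a b] c] d]. Qed.

Lemma triple_mapK (L L' : eqType) (f : L -> L') g :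
  cancel f g -> cancel (triple_map f) (triple_map g).
Proof. by move=> fK [[a b] c] /=; rewrite !fK. Qed.

(** The first conjunct of the new predicate says that all three letters lie in the image of [f]. *)
Lemma cov_inj (L L' : eqType) (f : L -> L') (g : L' -> L) (P : pred (L * L * L)) :
  cancel f g -> cov P ->
  cov (fun u => (triple_map f (triple_map g u) == u) && P (triple_map g u)).
Proof.
move=> fK [dec decP]; exists (fun u => word_map f (dec (triple_map g u))) => u.
case/andP=> /eqP e /decP[uw closed]; rewrite subwords_map; split.
  by rewrite -{1}e map_f.
move=> _ /mapP[v /closed[Pv dv] ->]; rewrite (triple_mapK fK) eqxx.
by rewrite dv.
Qed.

(** * Systems, and the code obtained from a system *)

Section Systems.
Variables (L : eqType) (pi : L -> L).

(* Triples that have to be covered: [aab], [abb] and [a (pi a) a] are excluded. *)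
Definition reltri (u : L * L * L) :=
  let: (a, b, c) := u in [&& a != b, b != c & ~~ ((c == a) && (b == pi a))].

Definition inside (h : pred L) (u : L * L * L) :=
  let: (a, b, c) := u in [&& h a, h b & h c].

Definition system (h : pred L) := cov (fun u => reltri u && ~~ inside h u).

End Systems.

Lemma system_bij (L L' : eqType) (pi : L -> L) (pi' : L' -> L') h h'
    (f : L -> L') (g : L' -> L) :
  cancel f g -> cancel g f -> (forall a, f (pi a) = pi' (f a)) ->
  (forall a, h' (f a) = h a) -> system pi h -> system pi' h'.
Proof.
move=> fK gK fpi fh sys; apply: eq_cov (cov_inj fK sys) => - [[a b] c] /=.
have fI := can_inj fK.
move: (gK a) (gK b) (gK c); move: (g a) (g b) (g c) => a' b' c' <- <- <-.
by rewrite eqxx !fh -fpi !(inj_eq fI).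
Qed.

Section CodeOfSystem.
Variables (q : nat) (pi : 'I_q -> 'I_q).
Hypotheses (piK : involutive pi) (pi_neq : forall a, pi a != a).

(** For a fixed middle letter [b] both outer letters avoid [b], and the pair [(pi b, pi b)] is
    excluded. *)
Lemma card_reltri : #|[pred u | reltri pi u]| = q * ((q - 1) ^ 2 - 1).
Proof.
pose f (u : 'I_q * 'I_q * 'I_q) := u.1.2.
rewrite -sum1_card (partition_big f predT) //= -[q in q * _]card_ord -sum_nat_const.
apply: eq_bigr => b _; rewrite sum1_card.
have -> : (q - 1) ^ 2 - 1 =
    #|setX [set~ b] [set~ b] :\ (pi b, pi b)|.
  have := cardsD1 (pi b, pi b) (setX [set~ b] [set~ b]).
  rewrite !inE /= pi_neq cardsX cardsC1 card_ord /=; nia.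
pose g (p : 'I_q * 'I_q) := (p.1, b, p.2).
have gI : injective g by move=> [? ?] [? ?] [-> ->].
rewrite -(card_imset _ gI); apply: eq_card => - [[a b'] c].
rewrite unfold_in /= unfold_in /= /f /=.
apply/andP/imsetP => [[/and3P[ab bc ne] /eqP e]|[[a' c']]].
  subst b'; exists (a, c); rewrite // !inE /= ab (eq_sym c) bc ?andbT.
  apply: contraNN ne.
  by rewrite xpair_eqE => /andP[/eqP-> /eqP->]; rewrite eqxx piK eqxx.
rewrite !inE xpair_eqE /= => /and3P[ne ab cb] [-> -> ->].
rewrite eqxx ab eq_sym cb; split=> //; apply: contraNN ne.
by case/andP=> /eqP-> /eqP->; rewrite piK eqxx.
Qed.

(** Triples with two equal neighbours are exactly the subwords of the words [aacc], so the two
    halves of the code do not interfere. A word of the system accounts for at most four triples,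
    which gives at least [q ^ 2 + q * ((q - 1) ^ 2 - 1) / 4] codewords, and this number is
    [q ^ 2 * (q + 2) / 4]. *)
Lemma code_of_system : system pi pred0 ->
  exists2 C : {set 4.-tuple 'I_q}, single_del_code C & q ^ 2 * (q + 2) <= 4 * #|C|.
Proof.
case=> dec0 dec0P.
pose dec (u : 'I_q * 'I_q * 'I_q) :=
  let: (a, b, c) := u in if (a == b) || (b == c) then (a, a, c, c) else dec0 u.
have decP u : reltri pi u -> u \in subwords (dec u) /\
    forall v, v \in subwords (dec u) -> reltri pi v /\ dec v = dec u.
  have decE v : reltri pi v -> dec v = dec0 v.
    by case: v => [[a b] c] /and3P[/negPf ab /negPf bc _]; rewrite /dec ab bc.
  move=> Ru; rewrite decE //; have [|uw closed] := dec0P u.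
    by rewrite Ru; case: (u) => [[? ?] ?].
  by split=> // v /closed[/andP[Rv _] <-]; split=> //; rewrite decE.
pose A : {set 4.-tuple 'I_q} :=
  [set tuple_of_word (p.1, p.1, p.2, p.2) | p : 'I_q * 'I_q].
pose B : {set 4.-tuple 'I_q} := [set tuple_of_word (dec u) | u in reltri pi].
have decA a c v : v \in subwords (a, a, c, c) -> ~~ reltri pi v /\ dec v = (a, a, c, c).
  by rewrite !inE => /or4P[] /eqP->; rewrite /= eqxx ?orbT ?andbF.
exists (A :|: B).
  apply/del_codeP => w w' u.
  suff dw (x : 'I_q * 'I_q * 'I_q * 'I_q) :
    tuple_of_word x \in A :|: B -> u \in subwords x -> dec u = x.
    by move=> Cw Cw' uw uw'; rewrite -(dw w) ?(dw w').
  rewrite inE => /orP[] /imsetP.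
    by case=> [[a c]] _ /(can_inj (@tuple_of_wordK _))-> /decA[].
  by case=> v Rv /(can_inj (@tuple_of_wordK _))-> /(decP _ Rv).2[].
have cA : #|A| = q ^ 2.
  rewrite card_imset ?card_prod ?card_ord ?mulnn // => - [a c] [a' c'].
  by move/(can_inj (@tuple_of_wordK _)) => [ea _ ec _]; subst.
have AB : [disjoint A & B].
  apply/pred0P => t /=; apply/negP => /andP[/imsetP[[a c] _ ->]].
  case/imsetP=> u Ru /(can_inj (@tuple_of_wordK _)) /= e.
  have [uw closed] := decP u Ru; rewrite -e in uw.
  by have [/negP[]] := decA _ _ _ uw.
have cB : q * ((q - 1) ^ 2 - 1) <= 4 * #|B|.
  rewrite -card_reltri -[X in X <= _]sum1_card.
  pose h (u : 'I_q * 'I_q * 'I_q) : {: 4.-tuple 'I_q} := tuple_of_word (dec u).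
  rewrite (partition_big h (fun t => t \in B)) /=; last first.
    by move=> u Ru; apply: imset_f.
  rewrite mulnC -sum_nat_const; apply: leq_sum => t _; rewrite sum1_card.
  have sz : size (subwords (word_of_tuple t)) = 4 by [].
  rewrite -[X in _ <= X]sz; apply: leq_trans (card_size _).
  apply/subset_leq_card/subsetP => u /andP[Ru /eqP<-].
  by rewrite tuple_of_wordK; apply: (decP u Ru).1.
rewrite cardsU disjoint_setI0 // cards0 subn0 cA.
by move: #|B| cB => m {AB cA A B decA decP dec0P dec}; case: (q) => [|[|n]]; nia.
Qed.

End CodeOfSystem.

(** * Perfect codes in the arrangements of a four-element block *)

Section PermutationCode.

(* A Varshamov-Tenengolts condition on the descents. *)
Definition vt (a b c d : nat) := ((b < a) + 2 * (c < b) + 3 * (d < c)) %% 4 == 0.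

(** Thus each of the 24 ordered triples from a 4-set lies in exactly one arrangement satisfying
    [vt]: six arrangements form a perfect code. The proof runs through the relative orders. *)
Lemma vt_insert (a b c d : nat) :
  a != b -> a != c -> b != c -> d != a -> d != b -> d != c ->
  vt d a b c + vt a d b c + vt a b d c + vt a b c d = 1.
Proof.
rewrite /vt => ab ac bc da db dc.
case: (ltngtP b a) => [?|?|e]; last (by rewrite e eqxx in ab);
case: (ltngtP c b) => [?|?|e]; try (by rewrite e eqxx in bc);
case: (ltngtP d a) => [?|?|e]; try (by rewrite e eqxx in da);
case: (ltngtP d b) => [?|?|e]; try (by rewrite e eqxx in db);
case: (ltngtP d c) => [?|?|e]; try (by rewrite e eqxx in dc); rewrite //=; lia.
Qed.

Variables (L : eqType) (r : L -> nat) (B : pred (L * L * L)) (p : L * L * L -> L).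
Hypothesis r_inj : injective r.
Hypotheses
  (B12 : forall a b c, B (a, b, c) -> B (b, a, c) /\ p (b, a, c) = p (a, b, c))
  (B23 : forall a b c, B (a, b, c) -> B (a, c, b) /\ p (a, c, b) = p (a, b, c))
  (B4 : forall a b c, B (a, b, c) ->
    B (a, b, p (a, b, c)) /\ p (a, b, p (a, b, c)) = c)
  (Bneq : forall a b c, B (a, b, c) -> a != b).

(** The hypotheses describe the ordered triples of a system of 4-element blocks, where [p] gives the
    fourth point. Each block contributes its arrangements satisfying [vt], for the order of letters
    induced by [r]; the decoder tries the four places for the missing letter. *)
Lemma cov_blocks : cov B.
Proof.
pose v (w : L * L * L * L) := let: (a, b, c, d) := w in vt (r a) (r b) (r c) (r d).
pose dec u := let: (a, b, c) := u in let d := p u in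
  if v (d, a, b, c) then (d, a, b, c) else if v (a, d, b, c) then (a, d, b, c)
  else if v (a, b, d, c) then (a, b, d, c) else (a, b, c, d).
have uniqv a b c (d := p (a, b, c)) : B (a, b, c) ->
    v (d, a, b, c) + v (a, d, b, c) + v (a, b, d, c) + v (a, b, c, d) = 1.
  move=> Babc; have [Bacb _] := B23 Babc; have [Bbac e1] := B12 Babc.
  have [Bbca _] := B23 Bbac.
  have [Babd _] := B4 Babc; have [Badb _] := B23 Babd; have [Bdab _] := B12 Badb.
  have [Bacd e2] := B4 Bacb; have [Bbad _] := B4 Bbac.
  have [Badc _] := B23 Bacd; have [Bdac _] := B12 Badc.
  have [Bdca _] := B23 Bdac.
  have [Bbda _] := B23 Bbad; have [Bdba _] := B12 Bbda.
  have e3 : p (a, c, b) = d by case: (B23 Babc).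
  have e4 : p (b, a, c) = d by case: (B12 Babc).
  apply: vt_insert; rewrite (inj_eq r_inj).
  - exact: (Bneq Babc).
  - exact: (Bneq Bacb).
  - exact: (Bneq Bbca).
  - exact: (Bneq Bdab).
  - by have := Bneq Bdba; rewrite e4.
  - by have := Bneq Bdca; rewrite e3.
pose F w := let: (a, b, c, d) := w in [/\ B (a, b, c), p (a, b, c) = d & v w].
apply: (@cov_family _ _ F dec) => [[[[a b] c] d] u [Babc e vw]|[[a b] c] Babc].
  have [Babd pabd] := B4 Babc; rewrite e in Babd pabd.
  have [Badb padb] := B23 Babd; have [Bdab pdab] := B12 Badb.
  have [Bacb pacb] := B23 Babc; have [Bacd pacd] := B4 Bacb.
  rewrite pacb e in Bacd pacd.
  have [Bbac pbac] := B12 Babc; have [Bbca pbca] := B23 Bbac.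
  have [Bbcd pbcd] := B4 Bbca; rewrite pbca pbac e in Bbcd pbcd.
  rewrite !inE => /or4P[] /eqP->; split=> //; rewrite /dec.
  - by rewrite pbcd vw.
  - have := uniqv _ _ _ Bacd; rewrite pacd vw.
    by case: (v (b, a, c, d)); case: (v (a, c, b, d)); case: (v (a, c, d, b)).
  - have := uniqv _ _ _ Babd; rewrite pabd vw.
    by case: (v (c, a, b, d)); case: (v (a, c, b, d)); case: (v (a, b, d, c)).
  have := uniqv _ _ _ Babc; rewrite e vw.
  by case: (v (d, a, b, c)); case: (v (a, d, b, c));
     case: (v (a, b, d, c)).
have := uniqv _ _ _ Babc; set d := p (a, b, c) => uv.
have [Babd pabd] := B4 Babc; rewrite -/d in Babd pabd.
have [Badb padb] := B23 Babd; have [Bdab pdab] := B12 Badb.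
have [Bacb pacb] := B23 Babc; have [Bacd pacd] := B4 Bacb.
have [Bbac pbac] := B12 Babc; have [Bbca pbca] := B23 Bbac.
rewrite pacb -/d in Bacd pacd.
case e1: (v (d, a, b, c)) uv => uv.
  by exists (d, a, b, c); rewrite ?inE ?eqxx //; split; rewrite ?e1 // pdab padb.
case e2: (v (a, d, b, c)) uv => uv.
  by exists (a, d, b, c); rewrite ?inE ?eqxx ?orbT //; split; rewrite ?e2 // padb.
case e3: (v (a, b, d, c)) uv => uv.
  by exists (a, b, d, c); rewrite ?inE ?eqxx ?orbT //; split; rewrite ?e3.
exists (a, b, c, d); rewrite ?inE ?eqxx ?orbT //; split=> //.
by move: uv; case: (v (a, b, c, d)).
Qed.

End PermutationCode.

(** * Triples on two or three orbits of the involution *)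

Section TwoClasses.
Variables (L : eqType) (pi : L -> L) (bit : pred L) (E : rel L).
Hypotheses (piK : involutive pi) (bit_pi : forall a, bit (pi a) = ~~ bit a).
Hypotheses (E_sym : symmetric E) (E_pi : forall a b, E (pi a) b = E a b)
  (E_irr : irreflexive E).

Lemma pi_neq_of_bit a : (pi a == a) = false.
Proof. by apply/eqP => e; have := bit_pi a; rewrite e; case: bit. Qed.

(** For two orbits related by [E] these are all 32 triples to be covered that meet both of them;
    there are eight words, one for each choice of the first two letters in different orbits. *)
Definition two_classes (u : L * L * L) := let: (a, b, c) := u in
  [|| (c == pi b) && E a b, (b == pi a) && E a c
    | ((c == a) || (c == pi a)) && E a b].

(* The words [a b (pi b) a] for [bit b], and [a b (pi b) (pi a)] otherwise. *)
Lemma cov_two_classes : cov two_classes.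
Proof.
have E_pir a b : E a (pi b) = E a b by rewrite E_sym E_pi E_sym.
have npi a : (a == pi a) = false by rewrite eq_sym pi_neq_of_bit.
have E_neq a b : E a b -> ((a == b) = false) * ((b == a) = false) *
    ((a == pi b) = false) * ((b == pi a) = false) *
    ((pi a == b) = false) * ((pi b == a) = false).
  have D x y : E x y -> (x == y) = false by apply: contraTF => /eqP->; rewrite E_irr.
  by move=> e; rewrite !D ?E_pi ?E_pir // E_sym ?E_pi ?E_pir.
pose fw a b := (a, b, pi b, if bit b then a else pi a).
pose dec u := let: (a, b, c) := u in
  if c == pi b then fw a b else
  if b == pi a then fw (if bit a then c else pi c) a else
  (* The word through [aba] or [a b (pi a)] is [fw a x] with [x] in the orbit of [b]; its last
     letter is [a] exactly when [bit x] holds, which selects [x]. *)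
  if bit b == (c == a) then fw a b else fw a (pi b).
pose F w := exists a b, E a b /\ w = fw a b.
apply: (@cov_family _ _ F dec) => [_ u [a [b [Eab ->]]] | [[a b] c] /or3P[]].
- have ne := E_neq _ _ Eab.
  rewrite !inE => /or4P[] /eqP->; rewrite /two_classes /dec /fw; case Bb: (bit b);
  rewrite ?piK ?eqxx ?E_pi ?E_pir ?[E b a]E_sym ?Eab ?ne ?(inj_eq (inv_inj piK))
    ?ne ?bit_pi ?Bb ?npi ?pi_neq_of_bit /= ?orbT ?eqxx ?npi ?pi_neq_of_bit ?piK /= ?ne ?Bb //.
- by case/andP=> /eqP-> Eab; exists (fw a b); [exists a, b | rewrite !inE eqxx !orbT].
- case/andP=> /eqP-> Eac; exists (fw (if bit a then c else pi c) a).
    by exists (if bit a then c else pi c), a; case: bit; rewrite ?E_pi E_sym.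
  by rewrite !inE; case: bit; rewrite ?piK eqxx.
case/andP=> ca Eab; exists (fw a (if bit b == (c == a) then b else pi b)).
  by exists a, (if bit b == (c == a) then b else pi b); case: eqP; rewrite ?E_pir.
rewrite !inE /fw; case: (eqVneq c a) ca => [->|ne] /=.
  by case Bb: (bit b); rewrite /= ?bit_pi ?Bb /= ?piK eqxx ?orbT.
move/eqP->; case Bb: (bit b); rewrite /= ?bit_pi ?Bb /= ?piK eqxx ?orbT //.
Qed.

End TwoClasses.

Section ThreeClasses.
Variables (L : eqType) (pi : L -> L) (bit : pred L) (E : rel L) (third : L -> L -> L).
Hypotheses (piK : involutive pi) (bit_pi : forall a, bit (pi a) = ~~ bit a).
Hypotheses (E_sym : symmetric E) (E_pi : forall a b, E (pi a) b = E a b)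
  (E_irr : irreflexive E).
Hypotheses (third_bit : forall a b, bit (third a b) = false)
  (third_sym : forall a b, third a b = third b a)
  (third_pi : forall a b, third (pi a) b = third a b)
  (E_third : forall a b, E a b -> E a (third a b))
  (third_third : forall a b, E a b ->
     third a (third a b) = if bit b then pi b else b).

Definition three_classes (u : L * L * L) := let: (a, b, c) := u in
  [|| (c == pi b) && E a b, (b == pi a) && E a c,
      ((c == a) || (c == pi a)) && E a b
    | E a b && ((c == third a b) || (c == pi (third a b)))].

(** Any two orbits related by [E] lie in one block of three orbits, and [third a b] is the
    representative of bit [false] of the third one. In a block, 3 * 32 triples meet two orbits and
    48 meet all three; the six words of [fam], taken for the six ordered pairs of representatives,
    make 36 words with 144 subwords. *)
Lemma cov_three_classes : cov three_classes.
Proof.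
have E_pir a b : E a (pi b) = E a b by rewrite E_sym E_pi E_sym.
have third_pir a b : third a (pi b) = third a b.
  by rewrite third_sym third_pi third_sym.
have npi a : (a == pi a) = false by rewrite eq_sym (pi_neq_of_bit bit_pi).
have npi' := pi_neq_of_bit bit_pi.
have E_neq a b : E a b -> ((a == b) = false) * ((b == a) = false) *
    ((a == pi b) = false) * ((b == pi a) = false) *
    ((pi a == b) = false) * ((pi b == a) = false).
  have D x y : E x y -> (x == y) = false by apply: contraTF => /eqP->; rewrite E_irr.
  by move=> e; rewrite !D ?E_pi ?E_pir // E_sym ?E_pi ?E_pir.
pose nrm a := if bit a then pi a else a.
pose dec (u : L * L * L) := let: (x, y, z) := u in
  if y == pi x then
    if bit x then if bit z then (pi z, x, y, z) else (x, third x z, y, z)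
    else (x, y, nrm z, pi (nrm z))
  else if z == pi y then
    if bit y then if bit x then (x, y, pi (third x y), z) else (x, y, z, pi x)
    else (nrm x, pi (nrm x), y, z)
  else if z == x then
    if bit y then (x, third x y, y, x) else (x, y, pi (third x y), x)
  else if z == pi x then
    if bit x then if bit y then (pi (third x y), x, y, z) else (x, y, z, third x y)
    else (x, pi (nrm y), nrm y, z)
  else match bit x, bit y, bit z with
    | false, false, false => (pi y, x, y, z)
    | _, false, true => (x, y, z, x)
    | false, true, _ => (z, x, y, z)
    | true, false, false => (x, y, pi x, z)
    | true, true, false => (x, pi z, y, z)
    | true, true, true => (x, y, z, pi y)
    end.
pose fam a b (c := third a b) := [:: (a, pi a, b, pi b); (a, pi b, b, pi a);
  (a, b, pi c, a); (pi a, b, pi c, pi a); (pi a, b, a, c); (pi a, pi b, pi c, b)].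
pose F w := exists a b, [/\ E a b, bit a = false, bit b = false & w \in fam a b].
have facts a b (c := third a b) : E a b -> bit a = false -> bit b = false ->
    [/\ E a c, E b c, third a c = b & third b c = a].
  move=> Eab Ba Bb; have Eac := E_third Eab.
  have Eba : E b a by rewrite E_sym.
  split=> //; first by rewrite /c third_sym E_third.
    by rewrite third_third // Bb.
  by rewrite /c (third_sym a) third_third // Ba.
apply: (@cov_family _ _ F dec).
  move=> w u [a [b [Eab Ba Bb]]].
  have [Eac Ebc tac tbc] := facts _ _ Eab Ba Bb; rewrite /fam.
  have Bc := third_bit a b.
  have tab : third a b = third a b by [].
  set c := third a b in tab Bc Eac Ebc tac tbc *.
  have tba : third b a = c by rewrite third_sym.
  have tca : third c a = b by rewrite third_sym.
  have tcb : third c b = a by rewrite third_sym.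
  have Eba : E b a by rewrite E_sym. have Eca : E c a by rewrite E_sym.
  have Ecb : E c b by rewrite E_sym.
  have R := (E_neq _ _ Eab, E_neq _ _ Eac, E_neq _ _ Ebc, Ba, Bb, Bc).
  have T := (tab, tba, tac, tca, tbc, tcb, Eab, Eba, Eac, Eca, Ebc, Ecb).
  rewrite !inE => /or4P[|||/or3P[]] /eqP->; rewrite !inE => /or4P[] /eqP->;
  rewrite /three_classes /dec /nrm ?piK ?(inj_eq (inv_inj piK)) ?E_pi ?E_pir
    ?third_pi ?third_pir ?bit_pi ?eqxx ?T ?R ?npi ?npi' ?piK /= ?eqxx ?R ?T ?orbT
    ?(inj_eq (inv_inj piK)) /= ?npi ?npi' ?R ?piK ?eqxx ?orbT //.
have wit a b i u : E a b -> bit a = false -> bit b = false -> i < 6 ->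
    u \in subwords (nth (a, a, a, a) (fam a b) i) -> exists2 w, F w & u \in subwords w.
  move=> Eab Ba Bb lti mu; exists (nth (a, a, a, a) (fam a b) i) => //.
  by exists a, b; split=> //; apply: mem_nth.
case=> [[x y] z] /or4P[].
- case/andP=> /eqP-> Exy; case By: (bit y); last first.
    by apply: (wit (nrm x) y 0); rewrite // /nrm; case Bx: (bit x);
      rewrite ?E_pi ?bit_pi ?Bx //= ?piK !inE eqxx ?orbT.
  case Bx: (bit x).
    by apply: (wit (pi x) (pi y) 5); rewrite ?E_pi ?E_pir ?bit_pi ?Bx ?By //= ?piK !inE eqxx ?orbT.
  by apply: (wit x (pi y) 1); rewrite ?E_pi ?E_pir ?bit_pi ?Bx ?By //= ?piK !inE eqxx ?orbT.
- case/andP=> /eqP-> Exz; case Bx: (bit x); last first.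
    by apply: (wit x (nrm z) 0); rewrite // /nrm; case Bz: (bit z);
      rewrite ?E_pir ?bit_pi ?Bz //= ?piK !inE eqxx ?orbT.
  case Bz: (bit z).
    by apply: (wit (pi z) (pi x) 1); rewrite ?E_pi ?E_pir 1?E_sym ?bit_pi ?Bx ?Bz //=;
    rewrite ?piK !inE eqxx ?orbT.
  apply: (wit (pi x) (third x z) 4); rewrite ?E_pi ?E_third ?bit_pi ?Bx //=.
  by rewrite third_pi third_third // Bz ?piK !inE eqxx ?orbT.
- case/andP=> zx Exy; have Ety := E_third Exy; have Byx : E y x by rewrite E_sym.
  have tt : third x (third x y) = nrm y by rewrite third_third.
  case/orP: zx => /eqP->; case By: (bit y); case Bx: (bit x).
  + apply: (wit (pi x) (third x y) 3); rewrite ?E_pi ?bit_pi ?Bx ?Ety //=.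
    by rewrite third_pi tt /nrm By !piK !inE eqxx ?orbT.
  + apply: (wit x (third x y) 2); rewrite ?E_pi ?bit_pi ?Bx ?Ety //=.
    by rewrite tt /nrm By !piK !inE eqxx ?orbT.
  + by apply: (wit (pi x) y 3); rewrite ?E_pi ?bit_pi ?Bx ?By //= !piK !inE eqxx ?orbT.
  + by apply: (wit x y 2); rewrite //= !inE eqxx ?orbT.
  + apply: (wit (third x y) (pi x) 5); rewrite ?E_pir ?bit_pi ?Bx //= 1?E_sym //.
    by rewrite third_pir (third_sym (third x y) x) tt /nrm By !piK !inE eqxx ?orbT.
  + by apply: (wit x (pi y) 1); rewrite ?E_pir ?bit_pi ?By //= !piK !inE eqxx ?orbT.
  + by apply: (wit (pi x) y 4); rewrite ?E_pi ?bit_pi ?Bx ?By //= !piK !inE eqxx ?orbT.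
  + by apply: (wit x y 1); rewrite //= !inE eqxx ?orbT.
case/andP=> Exy zt; have Ety := E_third Exy; have Eyx : E y x by rewrite E_sym.
have tt : third x (third x y) = nrm y by rewrite third_third.
have Etx : E (third x y) x by rewrite E_sym.
case/orP: zt => /eqP->; case By: (bit y); case Bx: (bit x).
+ apply: (wit (pi x) (third x y) 5); rewrite ?E_pi ?bit_pi ?Bx ?Ety //=.
  by rewrite third_pi tt /nrm By !piK !inE eqxx ?orbT.
+ apply: (wit (third x y) x 2); rewrite // /=.
  by rewrite (third_sym (third x y) x) tt /nrm By !piK !inE eqxx ?orbT.
+ by apply: (wit (pi x) y 4); rewrite ?E_pi ?bit_pi ?Bx ?By //= third_pi !piK !inE eqxx ?orbT.
+ by apply: (wit y x 4); rewrite //= third_sym !inE eqxx ?orbT.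
+ by apply: (wit (pi x) (pi y) 5); rewrite ?E_pi ?E_pir ?bit_pi ?Bx ?By //= third_pi third_pir !piK !inE eqxx ?orbT.
+ apply: (wit (third x y) x 3); rewrite // /=.
  by rewrite (third_sym (third x y) x) tt /nrm By !piK !inE eqxx ?orbT.
+ by apply: (wit (pi x) y 3); rewrite ?E_pi ?bit_pi ?Bx ?By //= third_pi !piK !inE eqxx ?orbT.
by apply: (wit x y 2); rewrite //= !inE eqxx ?orbT.
Qed.
End ThreeClasses.

(** * Triples with two letters in one group and one in another *)

Ltac neq_simp := repeat match goal with
  | H : is_true (?x != ?y) |- context [?x == ?y] => rewrite (negPf H)
  | H : is_true (?x != ?y) |- context [?y == ?x] => rewrite [y == x]eq_sym (negPf H)
  end.

Section Pairs.
Variables (S T G : finType) (pg : G -> G) (cp : G -> G -> G -> G) (m lt : rel G).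
Local Notation L := (S + T * G)%type.

Hypotheses (cp_l : forall x x', x != x' -> cp x x' x = x')
  (cp_sym : forall x x' y, x != x' -> cp x' x y = cp x x' y)
  (cp_neq : forall x x' y, x != x' -> cp x x' y != y)
  (cp_cp : forall x x' y z, x != x' -> cp y (cp x x' y) z = cp x x' z).
Hypothesis (cp_pg : forall x y, cp x (pg x) y = pg y).
Hypothesis (m_cp : forall x x' y, x != x' -> m y (cp x x' y) = m x x').
Hypothesis (lt_total : forall x y, x != y -> lt y x = ~~ lt x y).

Lemma cp_r x x' : x != x' -> cp x x' x' = x.
Proof. by move=> ne; rewrite cp_sym 1?eq_sym // cp_l 1?eq_sym. Qed.

Lemma cpK x x' y : x != x' -> cp x x' (cp x x' y) = y.
Proof. by move=> ne; rewrite -[LHS](cp_cp y) // cp_r // eq_sym cp_neq. Qed.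

Lemma cp_swap x x' y : x != x' -> cp y (cp x x' y) x = x'.
Proof. by move=> ne; rewrite cp_cp // cp_l. Qed.

Lemma cp_eq_pg x x' y : x != x' -> (cp x x' y == pg y) = (x' == pg x).
Proof.
move=> ne; apply/eqP/eqP => [e|->]; last by rewrite cp_pg.
by rewrite -(cp_swap y ne) e cp_pg.
Qed.

Lemma m_sym x x' : x != x' -> m x' x = m x x'.
Proof. by move=> ne; rewrite -(m_cp x' ne) cp_r. Qed.

(** The result lists the two letters of the same group in their order of occurrence, the tag of
    their group, the tag of the other group, and the remaining letter. *)
Definition paired (u : L * L * L) : option (G * G * T * T * G) :=
  match u with
  | (inr (i, x), inr (j, y), inr (l, z)) =>
    if i == j then if j == l then None else Some (x, y, i, l, z)
    else if j == l then Some (y, z, j, i, x)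
    else if i == l then Some (x, z, i, j, y) else None
  | _ => None
  end.

(** The other pairs lie in one orbit of [pg]; their triples meet only two orbits and are left to
    [two_classes]. *)
Definition generic_pair x x' := (x != x') && (x' != pg x).

Definition block_pair u :=
  if paired u is Some (x, x', _, _, _) then generic_pair x x' && m x x' else false.

Definition block_partner u : L :=
  if paired u is Some (x, x', i, l, y) then inr (l, cp x x' y) else u.2.

Lemma generic_pair_cp x x' y : generic_pair x x' -> generic_pair y (cp x x' y).
Proof.
by case/andP=> ne np; rewrite /generic_pair eq_sym cp_neq // cp_eq_pg.
Qed.

Hypothesis pgK : involutive pg.

Lemma generic_pair_sym x x' : generic_pair x x' -> generic_pair x' x.
Proof.
case/andP=> ne np; rewrite /generic_pair eq_sym ne; apply: contraNN np.
by move/eqP->; rewrite pgK.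
Qed.

(** A block consists of two edges of the same colour, placed in two different groups. The relation
    [m] is constant on colours and selects those treated in this way. *)
Lemma cov_block_pair : cov block_pair.
Proof.
pose r (a : L) : nat := enum_rank a.
have r_inj : injective r by move=> a b /val_inj/enum_rank_inj.
apply: (cov_blocks (p := block_partner) r_inj) => a b c;
  (case: a => [//|[i x]]; case: b => [//|[j y]]; case: c => [//|[l z]]);
  rewrite /block_pair /block_partner /=;
  (case: (eqVneq i j) => [?|ij]; [subst|]); (case: (eqVneq j l) => [?|jl]; [subst|]);
  rewrite ?eqxx; try (by []); neq_simp; rewrite //=.
- by case/andP=> g mm; have [ne _] := andP g; rewrite generic_pair_sym // m_sym // cp_sym.
- by case/andP=> g mm; have [ne _] := andP g; rewrite generic_pair_sym // m_sym // cp_sym.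
- by case: (i == l) => // /andP[-> ->].
- by case/andP=> g mm; have [ne _] := andP g; rewrite g mm cpK.
- case/andP=> g mm; have [ne _] := andP g.
  by rewrite generic_pair_cp //= m_cp // mm cp_swap.
- case: (eqVneq i l) => [?|//]; subst; case/andP=> g mm; have [ne _] := andP g.
  by rewrite eqxx generic_pair_cp //= m_cp // mm cp_swap.
- case/andP=> /andP[ne _] _; apply: contraNN ne.
  by move/eqP => [->].
- by move=> _; apply: contraNN ij => /eqP[->].
by move=> _; apply: contraNN ij => /eqP[->].
Qed.

(** For the remaining colours only triples whose two letters of the same group are adjacent; those
    with the odd letter in the middle are left to [ret_triple]. *)
Definition double_pair (u : L * L * L) := match u with
  | (inr (i, x), inr (j, y), inr (l, z)) =>
    (i != l) && if i == j then generic_pair x y && ~~ m x y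
                else (j == l) && (generic_pair y z && ~~ m y z)
  | _ => false
  end.

(** Two edges of the same colour, in groups [i] and [l] in this order, carry eight such triples.
    They are the subwords of two words: those in which both edges are traversed upwards, or both
    downwards, with respect to [lt]. *)
Lemma cov_double_pair : cov double_pair.
Proof.
pose dec (u : L * L * L) : L * L * L * L := match u with
  | (inr (i, x), inr (j, y), inr (l, z)) =>
    if i == j then let z' := cp x y z in
      if lt x y == lt z z' then (inr (i, x), inr (i, y), inr (l, z), inr (l, z'))
      else (inr (i, x), inr (i, y), inr (l, z'), inr (l, z))
    else let x' := cp y z x in
      if lt x x' == lt y z then (inr (i, x), inr (i, x'), inr (l, y), inr (l, z))
      else (inr (i, x'), inr (i, x), inr (l, y), inr (l, z))
  | _ => (u, u.2)
  end.
pose F (w : L * L * L * L) := exists i l x x' y,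
  [/\ i != l, generic_pair x x' /\ ~~ m x x', lt x x' == lt y (cp x x' y)
    & w = (inr (i, x), inr (i, x'), inr (l, y), inr (l, cp x x' y))].
apply: (@cov_family _ _ F dec).
  move=> _ u [i [l [x [x' [y [il [g nm] ltxy ->]]]]]].
  have [ne _] := andP g; have ne' : y != cp x x' y by rewrite eq_sym cp_neq.
  have [e1 e2] := (lt_total ne, lt_total ne').
  rewrite !inE => /or4P[] /eqP->; rewrite /double_pair /dec ?eqxx ?(negPf il) //=.
  - rewrite generic_pair_cp //= m_cp // nm cp_cp // cp_r // e1 -(eqP ltxy).
    by case: (lt x x').
  - by rewrite generic_pair_cp //= m_cp // nm cp_cp // cp_l // ltxy.
  - by rewrite g nm cpK // e2 -(eqP ltxy); case: (lt x x').
  by rewrite g nm ltxy.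
case=> [[[//|[i x]] [//|[j y]]] [//|[l z]]] /= /andP[il].
case: (eqVneq i j) => [<-|ij].
  case/andP=> g nm; have [ne _] := andP g.
  have ne' : z != cp x y z by rewrite eq_sym cp_neq.
  case: (eqVneq (lt x y) (lt z (cp x y z))) => e.
    exists (inr (i, x), inr (i, y), inr (l, z), inr (l, cp x y z)).
      by exists i, l, x, y, z; rewrite e.
    by rewrite !inE eqxx ?orbT.
  exists (inr (i, x), inr (i, y), inr (l, cp x y z), inr (l, z)).
    exists i, l, x, y, (cp x y z); rewrite cpK //; split=> //.
    by rewrite (lt_total ne'); move: e; case: (lt x y); case: (lt z _).
  by rewrite !inE eqxx ?orbT.
case/andP=> /eqP<- /andP[g nm]; have [ne _] := andP g.
have ne' : x != cp y z x by rewrite eq_sym cp_neq.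
case: (eqVneq (lt x (cp y z x)) (lt y z)) => e.
  exists (inr (i, x), inr (i, cp y z x), inr (j, y), inr (j, z)).
    exists i, j, x, (cp y z x), y; rewrite cp_cp // cp_l // e; split=> //.
    by rewrite generic_pair_cp // m_cp.
  by rewrite !inE eqxx ?orbT.
exists (inr (i, cp y z x), inr (i, x), inr (j, y), inr (j, z)).
  exists i, j, (cp y z x), x, y; rewrite (cp_sym _ ne') cp_cp // cp_l //; split=> //.
    by rewrite generic_pair_sym ?generic_pair_cp // m_sym // m_cp.
  by rewrite (lt_total ne'); move: e; case: (lt x _); case: (lt y z).
by rewrite !inE eqxx ?orbT.
Qed.

End Pairs.

(** * Triples that meet three groups *)

(** [option bool] serves as the set of three group tags in cyclic order, and the bit of [rot3] as a
    direction of rotation. *)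
Definition nxt (i : option bool) : option bool :=
  match i with None => Some false | Some false => Some true | Some true => None end.
Definition rot3 (b : bool) i := if b then nxt i else nxt (nxt i).
Definition tag3 i j := if j == nxt i then nxt (nxt i) else nxt i.

Section ThreeGroups.
Local Open Scope ring_scope.
Variables (S : finType) (G : finComNzRingType).
Local Notation L := (S + option bool * G)%type.

Section Returning.
Variables (D R : bool -> pred G) (dl : bool -> G -> G) (minv : G -> option (bool * G)).
Hypotheses
  (D_R : forall b t, D b t -> R b (t + dl b t) /\ dl b (t + dl b t) = - dl b t)
  (R_D : forall b t, R b t -> D b (t + dl b t) /\ dl b (t + dl b t) = - dl b t)
  (DnR : forall b t, R b t -> D b t = false)
  (minvD : forall b t, D b t -> minv (dl b t) = Some (b, t))
  (minvP : forall d b t, minv d = Some (b, t) -> D b t /\ dl b t = d).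

(* The triples covered by words whose first and last letters lie in the same group, at a
   difference [dl b t] realised by the matching, [t] being the sum of three letters. *)
Definition ret_triple (u : L * L * L) := match u with
  | (inr (i, x), inr (j, y), inr (l, z)) =>
    if (i == j) || (j == l) then false
    else if i == l then minv (z - x) : bool
    else let b := j == nxt i in D b (x + y + z) || R b (x + y + z)
  | _ => false
  end.

(** In [word i b x y t] the first three letters have sum [t] in [D b], the last three have sum
    [t + dl b t] in [R b], and deleting a middle letter leaves the difference [dl b t] between the
    outer ones, from which [minv] recovers [b] and [t]. Disjointness of [D b] and [R b] tells the
    decoder which end is missing. *)
Lemma cov_ret_triple : cov ret_triple.
Proof.
pose dec (u : L * L * L) : L * L * L * L := match u with
  | (inr (i, x), inr (j, y), inr (l, z)) =>
    if i == l then
      if minv (z - x) is Some (b, t) then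
        let a := inr (tag3 i j, t - x - y) in
        if j == rot3 b i then (inr (i, x), inr (j, y), a, inr (l, z))
        else (inr (i, x), a, inr (j, y), inr (l, z))
      else (u, u.2)
    else let b := j == nxt i in let t := x + y + z in
      if D b t then (u, inr (i, x + dl b t))
      else (inr (l, z + dl b t), inr (i, x), inr (j, y), inr (l, z))
  | _ => (u, u.2)
  end.
pose word i b x y t : L * L * L * L := (inr (i, x), inr (rot3 b i, y),
  inr (rot3 b (rot3 b i), t - x - y), inr (i, x + dl b t)).
pose F w := exists i b x y t, D b t /\ w = word i b x y t.
apply: (@cov_family _ _ F dec).
  move=> _ u [i [b [x [y [t [Dt ->]]]]]]; have [Rt' e'] := D_R Dt.
  have e1 : y + (t - x - y) + (x + dl b t) = t + dl b t by ring.
  have e2 : x + dl b t - x = dl b t by ring.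
  have e3 : x + y + (t - x - y) = t by ring.
  have e4 : t - x - (t - x - y) = y by ring.
  rewrite !inE => /or4P[] /eqP->; rewrite /ret_triple /dec /word.
  - by case: i b Dt Rt' e' e1 {e2} => [[]|] [] Dt Rt' e' e1; rewrite /= e1 (DnR Rt') Rt' ?orbT e' addrK.
  - by case: i b Dt Rt' e' e1 e2 => [[]|] [] Dt Rt' e' e1 e2; rewrite /= e2 (minvD Dt) /= e4.
  - by case: i b Dt Rt' e' e1 e2 => [[]|] [] Dt Rt' e' e1 e2; rewrite /= e2 (minvD Dt) /=.
  by case: i b Dt Rt' e' e1 e2 => [[]|] [] Dt Rt' e' e1 e2; rewrite /= e3 Dt.
case=> [[[//|[i x]] [//|[j y]]] [//|[l z]]] /=.
case: (eqVneq i j) => //= ij; case: (eqVneq j l) => //= jl.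
case: (eqVneq i l) => [il|il].
  subst l; case e: (minv _) => [[b t]|//] _; have [Dt dt] := minvP e.
  have e1 : z = x + dl b t by rewrite dt; ring.
  case: (eqVneq j (rot3 b i)) => ej.
    exists (word i b x y t); first by exists i, b, x, y, t.
    by rewrite !inE -e1 -ej eqxx ?orbT.
  exists (word i b x (t - x - y) t); first by exists i, b, x, (t - x - y), t.
  have e2 : t - x - (t - x - y) = y by ring.
  have ej2 : rot3 b (rot3 b i) = j by move: ij ej; case: (i) (j) (b) => [[]|] [[]|] [].
  by rewrite /word e2 ej2 !inE -e1 eqxx ?orbT.
set b := j == nxt i; set t := x + y + z => DRt.
have ej : j = rot3 b i by rewrite /b; move: ij jl il; case: (i) (j) (l) => [[]|] [[]|] [[]|].
have el : l = rot3 b j by rewrite /b; move: ij jl il; case: (i) (j) (l) => [[]|] [[]|] [[]|].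
case Dt: (D b t) DRt => /= Rt.
  exists (word i b x y t); first by exists i, b, x, y, t.
  have e2 : t - x - y = z by rewrite /t; ring.
  by rewrite /word e2 !inE -ej -el eqxx ?orbT.
have [Dt' dt'] := R_D Rt.
exists (word l b (z + dl b t) x (t + dl b t)).
  by exists l, b, (z + dl b t), x, (t + dl b t).
have ei : i = rot3 b l by rewrite /b; move: ij jl il; case: (i) (j) (l) => [[]|] [[]|] [[]|].
rewrite /word -ei -ej dt' addrK.
have -> : t + dl b t - (z + dl b t) - x = y by rewrite /t; ring.
by rewrite !inE eqxx.
Qed.
End Returning.

Section Infinity.
Variables (e : S -> G) (einv : G -> option S).
Hypotheses (eK : forall s, einv (e s) = Some s) (einvP : forall t s, einv t = Some s -> e s = t).

Definition inf_block (u : L * L * L) := match u with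
  | (inr (i, x), inr (j, y), inr (l, z)) =>
    [&& i != j, j != l, i != l & einv (x + y + z) : bool]
  | (inl _, inr (i, _), inr (j, _)) | (inr (i, _), inl _, inr (j, _))
  | (inr (i, _), inr (j, _), inl _) => i != j
  | _ => false
  end.

Definition inf_partner (u : L * L * L) : L := match u with
  | (inr (i, x), inr (j, y), inr (l, z)) =>
    if einv (x + y + z) is Some s then inl s else u.2
  | (inl s, inr (i, x), inr (j, y)) | (inr (i, x), inl s, inr (j, y))
  | (inr (i, x), inr (j, y), inl s) => inr (tag3 i j, e s - x - y)
  | _ => u.2
  end.

(** A block consists of an extra letter [s] and one letter from each group, the three having sum
    [e s]; any three points determine the fourth. *)
Lemma cov_inf_block : cov inf_block.
Proof.
pose r (a : L) : nat := enum_rank a.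
have r_inj : injective r by move=> a b /val_inj/enum_rank_inj.
have tag3C i j : i != j -> tag3 j i = tag3 i j by case: i j => [[]|] [[]|].
have tag3N i j : i != j -> (i != tag3 i j) * (j != tag3 i j) * (tag3 i j != i) * (tag3 i j != j).
  by case: i j => [[]|] [[]|].
have tag3K i j : i != j -> (tag3 i (tag3 i j) = j) * (tag3 j (tag3 i j) = i) *
   (tag3 (tag3 i j) i = j) * (tag3 (tag3 i j) j = i) by case: i j => [[]|] [[]|].
have tag3E i j l : i != j -> j != l -> i != l -> (tag3 i j = l) * (tag3 j l = i) * (tag3 i l = j).
  by case: i j l => [[]|] [[]|] [[]|].
apply: (cov_blocks (p := inf_partner) r_inj) => a b c.
- case: a b c => [s|[i x]] [s'|[j y]] [s''|[l z]] //= ij.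
  + by split; [rewrite eq_sym | rewrite tag3C // addrAC].
  case/and4P: ij => ij jl il es.
  by rewrite [j == i]eq_sym ij il jl [y + x]addrC es.
- case: a b c => [s|[i x]] [s'|[j y]] [s''|[l z]] //= ij.
  + by split; [rewrite eq_sym | rewrite tag3C // addrAC].
  case/and4P: ij => ij jl il es.
  rewrite [l == j]eq_sym ij il jl addrAC es; split=> //.
  by case: (einv _) es.
- case: a b c => [s|[i x]] [s'|[j y]] [s''|[l z]] //= ij.
  + rewrite tag3N //; split=> //; rewrite tag3K //; congr (inr (_, _)); ring.
  + rewrite tag3N //; split=> //; rewrite tag3K //; congr (inr (_, _)); ring.
  + have [n1 n2] : i != tag3 i j /\ j != tag3 i j by rewrite !tag3N.
    have -> : x + y + (e s'' - x - y) = e s'' by ring.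
    by rewrite eK ij n1 n2.
  case/and4P: ij => ij jl il; case E: (einv _) => [s|//] _; split=> //=.
  rewrite (einvP E) (tag3E i j l) //; congr (inr (_, _)); ring.
case: a b c => [s|[i x]] [s'|[j y]] [s''|[l z]] //= ij.
  by apply: contraNN ij => /eqP[->].
by case/and4P: ij => ij _ _ _; apply: contraNN ij => /eqP[->].
Qed.
End Infinity.
End ThreeGroups.

(** * Gluing the fillings of the groups to the outer triples *)

Section Assemble.
Variables (S T G : finType) (ps : S -> S) (pg : G -> G).
Local Notation L := (S + T * G)%type.

Definition pair_pi (a : S + G) : S + G :=
  match a with inl s => inl (ps s) | inr x => inr (pg x) end.
Definition group_pi (a : L) : L :=
  match a with inl s => inl (ps s) | inr (i, x) => inr (i, pg x) end.

Definition in_group i (a : L) := if a is inr (j, _) then j == i else true.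
Definition outer (u : L * L * L) := ~~ [exists i, inside (in_group i) u].

Definition embed i (a : S + G) : L :=
  match a with inl s => inl s | inr x => inr (i, x) end.
Definition retract (a : L) : S + G :=
  match a with inl s => inl s | inr (_, x) => inr x end.

Variable h : pred L.

(** The fillings do not overlap: a triple in two groups, each enlarged by the extra letters,
    consists of extra letters only, and the first hypothesis puts it in the hole. *)
Lemma assemble :
    (forall s s' s'', reltri group_pi (inl s, inl s', inl s'') ->
       inside h (inl s, inl s', inl s'')) ->
    (forall i, system pair_pi (h \o embed i)) ->
    cov (fun u => (reltri group_pi u && ~~ inside h u) && outer u) ->
  system group_pi h.
Proof.
move=> HS fill out.
pose sel u := [pick i | inside (in_group i) u].
apply: (cov_sel (sel := sel)) => - [i|]; last first.
  apply: eq_cov out => u; congr (_ && _); rewrite /sel /outer.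
  case: pickP => [i Hi|H0]; first by apply/negbTE; rewrite negbK; apply/existsP; exists i.
  by rewrite eqxx; apply/existsP => - [i]; rewrite H0.
have eK : cancel (embed i) retract by case.
apply: eq_cov (cov_inj eK (fill i)) => - [[a b] c].
have ini x : (embed i (retract x) == x) = in_group i x.
  by case: x => [s|[j x]] /=; [rewrite eqxx | apply/eqP/eqP => [[->]|->]].
have -> : (triple_map (embed i) (triple_map retract (a, b, c)) == (a, b, c)) =
    inside (in_group i) (a, b, c) by rewrite /= !xpair_eqE !ini andbA.
case Hi : (inside (in_group i) (a, b, c)); last first.
  apply/esym/negbTE; rewrite negb_and /sel.
  case: pickP => [j Hj|_]; last by rewrite orbT.
  by apply/orP; right; apply: contraFneq Hi => - [<-].
have pi_i x : embed i (pair_pi x) = group_pi (embed i x) by case: x.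
have [ia ib ic] := and3P Hi; move: ia ib ic; rewrite -!ini => /eqP ia /eqP ib /eqP ic.
move: Hi; rewrite -ia -ib -ic; move: (retract a) (retract b) (retract c) => {ia ib ic}x y z.
rewrite /= !eK -pi_i !(inj_eq (can_inj eK)) /sel.
move=> Hi; match goal with |- ?Q = _ => case sxyz : Q => //= end.
case: pickP => [j Hj|/(_ i)]; last by rewrite /= Hi.
suff -> : j = i by rewrite eqxx.
move/and3P: Hj => [ja jb jc]; clear Hi.
case: x y z sxyz ja jb jc => [s|x] [s'|y] [s''|z] sxyz /= ja jb jc;
  try by [rewrite (eqP ja) | rewrite (eqP jb) | rewrite (eqP jc)].
case/andP: sxyz => rl /negP[].
have := HS s s' s''; rewrite /= -[inl (ps s)]/(embed i (pair_pi (inl s))).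
rewrite -[inl s]/(embed i (inl s)) -[inl s']/(embed i (inl s')) -[inl s'']/(embed i (inl s'')).
by rewrite !(inj_eq (can_inj eK)) => /(_ rl).
Qed.
End Assemble.

Section Outer.
Variables (S T G : finType) (i0 : T) (ps : S -> S) (pg : G -> G).
Local Notation L := (S + T * G)%type.
Local Notation pi := (@group_pi S T G ps pg).

Definition cross (a b : L) :=
  match a, b with inr (i, _), inr (j, _) => i != j | _, _ => false end.

Lemma outerE (a b c : L) : outer (a, b, c) =
  match a, b, c with
  | inr (i, _), inr (j, _), inr (l, _) => ~~ ((i == j) && (j == l))
  | inl _, inr (i, _), inr (j, _) | inr (i, _), inl _, inr (j, _)
  | inr (i, _), inr (j, _), inl _ => i != j
  | _, _, _ => false
  end.
Proof.
rewrite /outer; case: a b c => [s|[i x]] [s'|[j y]] [s''|[l z]] /=.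
- by apply/negbTE; rewrite negbK; apply/existsP; exists i0.
- by apply/negbTE; rewrite negbK; apply/existsP; exists l; rewrite eqxx.
- by apply/negbTE; rewrite negbK; apply/existsP; exists j; rewrite eqxx.
- congr (~~ _); apply/existsP/eqP => [[k /andP[/eqP-> /eqP->]]|->] //.
  by exists l; rewrite eqxx.
- by apply/negbTE; rewrite negbK; apply/existsP; exists i; rewrite eqxx.
- congr (~~ _); apply/existsP/eqP => [[k /andP[/eqP-> /eqP->]]|->] //.
  by exists l; rewrite eqxx.
- congr (~~ _); apply/existsP/eqP => [[k /and3P[/eqP-> /eqP-> _]]|->] //.
  by exists j; rewrite eqxx.
congr (~~ _); apply/existsP/andP => [[k /and3P[/eqP-> /eqP-> /eqP->]]|] //.
by case=> /eqP-> /eqP->; exists l; rewrite eqxx.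
Qed.

Hypothesis pg_neq : forall x, pg x != x.

Implicit Type u : L * L * L.

Lemma paired_outer u q : paired u = Some q -> outer u.
Proof.
case: u => [[[//|[i x]] [//|[j y]]] [//|[l z]]]; rewrite outerE /=.
by case: (i == j) (j == l) (i == l) => [] [] [].
Qed.

(** This and the next two lemmas give a dichotomy: a paired triple with a generic pair meets three
    orbits, and the other paired triples to be covered are exactly those of [two_classes]. *)
Lemma paired_generic u x x' i l y : paired u = Some (x, x', i, l, y) ->
  generic_pair pg x x' -> reltri pi u /\ ~~ two_classes pi cross u.
Proof.
case: u => [[[//|[j a]] [//|[k b]]] [//|[n c]]] /=.
have pE (r s : T * G) : (inr r == inr s :> L) = (r == s) by [].
rewrite !pE !xpair_eqE.
have [?|jk] := eqVneq j k; have [?|kn] := eqVneq k n; subst => //;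
  rewrite ?eqxx; neq_simp.
- case=> ? ? ? ? ?; subst; case/andP=> ne np.
  by rewrite [_ == pg _]eq_sym in np; rewrite ?ne ?eqxx /= ?[x' == pg x]eq_sym (negPf np) ?andbF.
- case=> ? ? ? ? ?; subst; case/andP=> ne np.
  by rewrite ne /= (negPf np) ?andbF ?orbF.
- have [?|//] := eqVneq j n; subst; case=> ? ? ? ? ?; subst; case/andP=> ne np.
  by rewrite [x' == x]eq_sym (negPf ne) (negPf np) /= ?andbF.
Qed.

Lemma paired_special u x x' i l y : paired u = Some (x, x', i, l, y) ->
  ~~ generic_pair pg x x' -> reltri pi u -> two_classes pi cross u.
Proof.
case: u => [[[//|[j a]] [//|[k b]]] [//|[n c]]] /=.
have pE (r s : T * G) : (inr r == inr s :> L) = (r == s) by [].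
rewrite !pE !xpair_eqE /generic_pair negb_and !negbK.
have [?|jk] := eqVneq j k; have [?|kn] := eqVneq k n; subst => //;
  rewrite ?eqxx; neq_simp.
- by case=> ? ? ? ? ?; subst; rewrite /= => /orP[/eqP->|->]; rewrite ?eqxx ?orbT.
- by case=> ? ? ? ? ?; subst; rewrite /= => /orP[/eqP->|->]; rewrite ?eqxx ?orbT ?andbF.
- have [?|//] := eqVneq j n; subst; case=> ? ? ? ? ?; subst.
  by rewrite /= => /orP[/eqP->|->]; rewrite ?eqxx ?orbT ?andbT.
Qed.

Lemma two_classes_paired u : two_classes pi cross u ->
  reltri pi u /\ exists x x' i l y,
    paired u = Some (x, x', i, l, y) /\ ~~ generic_pair pg x x'.
Proof.
case: u => [[[s|[j a]] [s'|[k b]]] [s''|[n c]]] /=; rewrite ?andbF //.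
have pE (r s : T * G) : (inr r == inr s :> L) = (r == s) by [].
rewrite !pE !xpair_eqE /generic_pair.
have [?|jk] := eqVneq j k; have [?|kn] := eqVneq k n; subst => //=;
  rewrite ?eqxx ?andbF ?andbT ?orbF //=; neq_simp; rewrite /= ?andbT ?andbF ?orbF //=.
- move/eqP->; split; last by exists a, (pg a), k, n, c; rewrite eqxx andbF.
  by rewrite eq_sym pg_neq.
- move/eqP->; split; last by exists b, (pg b), n, j, a; rewrite eqxx andbF.
  by rewrite eq_sym pg_neq.
have [?|jn] := eqVneq j n; subst; rewrite ?eqxx //=.
move=> ac; split=> //.
by exists a, c, n, k, b; case/orP: ac => /eqP->; rewrite eqxx ?andbF.
Qed.

Variable h : pred L.
Hypothesis h_pi : forall a, h (pi a) = h a.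

(** Two orbits inside the hole are dropped together. The hole being a union of orbits, no word of
    [two_classes] is cut apart. *)
Definition free_cross (a b : L) := cross a b && ~~ (h a && h b).

Lemma two_classes_free u :
  two_classes pi free_cross u = two_classes pi cross u && ~~ inside h u.
Proof.
case: u => [[a b] c]; rewrite /two_classes /free_cross /inside.
apply/idP/andP => [|[H nh]].
  case/or3P=> /andP[e /andP[X nh]]; rewrite X e ?orbT; split=> //.
  - by rewrite (eqP e) h_pi andbb.
  - by rewrite (eqP e) h_pi andbA andbb.
  - by apply: contraNN nh => /and3P[-> ->].
case/or3P: H => /andP[e X]; rewrite X e /=.
- by rewrite (eqP e) h_pi andbb in nh; rewrite nh.
- by rewrite (eqP e) h_pi andbA andbb in nh; rewrite nh orbT.
have hc : h c = h a by case/orP: e => /eqP->; rewrite ?h_pi.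
by move: nh; rewrite hc andbCA andbb andbC => ->; rewrite !orbT.
Qed.

Lemma system_pred_outer u : two_classes pi free_cross u =
  ((reltri pi u && ~~ inside h u) && outer u) &&
  (if paired u is Some (x, x', _, _, _) then ~~ generic_pair pg x x' else false).
Proof.
rewrite two_classes_free; apply/andP/andP.
  case=> /two_classes_paired[-> [x [x' [i [l [y [e ng]]]]]] nh].
  by rewrite e ng nh (paired_outer e).
case=> /andP[/andP[rl nh] _]; case e: (paired u) => [[[[[x x'] i] l] y]|//] ng.
by split=> //; apply: (paired_special e ng).
Qed.

End Outer.

Lemma cov_split (L : eqType) (P Q : pred (L * L * L)) :
  cov (fun u => P u && Q u) -> cov (fun u => P u && ~~ Q u) -> cov P.
Proof.
move=> PQ PnQ; apply: (cov_sel (sel := Q)) => - [].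
  by apply: eq_cov PQ => u; rewrite eqb_id.
by apply: eq_cov PnQ => u; rewrite eqbF_neg.
Qed.

Section RankBit.
Variables (L : finType) (pi : L -> L).
Hypotheses (piK : involutive pi) (pi_neq : forall a, pi a != a).

Definition rank_bit (a : L) := enum_rank a < enum_rank (pi a).

Lemma rank_bit_pi a : rank_bit (pi a) = ~~ rank_bit a.
Proof.
rewrite /rank_bit piK -leqNgt [RHS]leq_eqVlt; case: eqP => // e.
by case/eqP: (pi_neq a); apply: enum_rank_inj; apply: ord_inj.
Qed.
End RankBit.

Section GroupPi.
Variables (S T G : finType) (ps : S -> S) (pg : G -> G).
Hypotheses (psK : involutive ps) (ps_neq : forall s, ps s != s).
Hypotheses (pgK : involutive pg) (pg_neq : forall x, pg x != x).
Local Notation pi := (@group_pi S T G ps pg).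

Lemma group_piK : involutive pi.
Proof. by case=> [s|[i x]] /=; rewrite ?psK ?pgK. Qed.

Lemma group_pi_neq a : pi a != a.
Proof.
case: a => [s|[i x]]; apply/eqP => - [].
  by move/eqP; rewrite (negPf (ps_neq s)).
by move/eqP; rewrite (negPf (pg_neq x)).
Qed.

Lemma cross_sym : symmetric (@cross S T G).
Proof. by case=> [s|[i x]] [s'|[j y]] //=; rewrite eq_sym. Qed.

Lemma cross_pi a b : cross (pi a) b = cross a b.
Proof. by case: a => [s|[i x]]; case: b => [s'|[j y]]. Qed.

Lemma cross_irr : irreflexive (@cross S T G).
Proof. by case=> [s|[i x]] //=; rewrite eqxx. Qed.

Lemma cov_free_cross (h : pred (S + T * G)) : (forall a, h (pi a) = h a) ->
  cov (two_classes pi (free_cross h)).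
Proof.
move=> h_pi; apply: (cov_two_classes (bit := rank_bit pi)).
- exact: group_piK.
- exact: (rank_bit_pi group_piK group_pi_neq).
- by move=> a b; rewrite /free_cross cross_sym andbC [h b && _]andbC andbC.
- by move=> a b; rewrite /free_cross cross_pi h_pi.
by move=> a; rewrite /free_cross cross_irr.
Qed.
End GroupPi.

(** * Outer triples of two groups and of three groups *)

Section DoubleOuter.
Variables (G : finType) (pg : G -> G) (cp : G -> G -> G -> G).
Hypotheses (pgK : involutive pg) (pg_neq : forall x, pg x != x).
Hypotheses (cp_l : forall x x', x != x' -> cp x x' x = x')
  (cp_sym : forall x x' y, x != x' -> cp x' x y = cp x x' y)
  (cp_neq : forall x x' y, x != x' -> cp x x' y != y)
  (cp_cp : forall x x' y z, x != x' -> cp y (cp x x' y) z = cp x x' z)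
  (cp_pg : forall x y, cp x (pg x) y = pg y).
Local Notation L := (void + bool * G)%type.
Local Notation pi := (@group_pi void bool G id pg).
Variable h : pred L.
Hypotheses (h_pi : forall a, h (pi a) = h a)
  (h_out : forall u, reltri pi u -> inside h u -> outer u -> two_classes pi (@cross _ _ _) u).

(** With two groups and no extra letters every outer triple is paired, so blocks of all colours and
    two-orbit words suffice. The hypothesis [h_out] keeps the triples of blocks out of the hole. *)
Lemma cov_double_outer :
  cov (fun u => (reltri pi u && ~~ inside h u) && outer u).
Proof.
apply: (cov_split (Q := block_pair pg (fun _ _ => true))).
  apply: eq_cov (cov_block_pair void bool (m := fun _ _ => true)
    cp_l cp_sym cp_neq cp_cp cp_pg _ pgK) => // u.
  case Bu: block_pair; rewrite ?andbF //= andbT; apply/esym.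
  move: Bu; rewrite /block_pair; case e: (paired u) => [[[[[x x'] i] l] y]|//].
  rewrite andbT => g; have [rl nt] := paired_generic id e g.
  have out := paired_outer true e; rewrite rl out andbT /=.
  by apply: contraNN nt => iu; apply: h_out.
have psn (s : void) : id s != s by case: s.
apply: eq_cov (cov_free_cross (fun=> erefl) psn pgK pg_neq h_pi) => u.
rewrite (system_pred_outer true pg_neq h_pi).
case out: (outer u); rewrite ?andbF ?andbT //; congr (_ && _); rewrite /block_pair.
case e: (paired u) => [[[[[x x'] i] l] y]|]; first by rewrite andbT.
move: u out e => [[[[]|[i x]] [[]|[j y]]] [[]|[l z]]]; rewrite (outerE true) /=.
by case: i j l => [] [] [].
Qed.
End DoubleOuter.

Section TripleOuter.
Variables (S : finType) (G : finComNzRingType) (ps : S -> S) (pg : G -> G).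
Variables (cp : G -> G -> G -> G) (lt : rel G).
Hypotheses (psK : involutive ps) (ps_neq : forall s, ps s != s).
Hypotheses (pgK : involutive pg) (pg_neq : forall x, pg x != x).
Hypotheses (cp_l : forall x x', x != x' -> cp x x' x = x')
  (cp_sym : forall x x' y, x != x' -> cp x' x y = cp x x' y)
  (cp_neq : forall x x' y, x != x' -> cp x x' y != y)
  (cp_cp : forall x x' y z, x != x' -> cp y (cp x x' y) z = cp x x' z)
  (cp_pg : forall x y, cp x (pg x) y = pg y).
Hypothesis (lt_total : forall x y, x != y -> lt y x = ~~ lt x y).
Variables (D R : bool -> pred G) (dl : bool -> G -> G) (minv : G -> option (bool * G)).
Local Open Scope ring_scope.
Hypotheses
  (D_R : forall b t, D b t -> R b (t + dl b t) /\ dl b (t + dl b t) = - dl b t)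
  (R_D : forall b t, R b t -> D b (t + dl b t) /\ dl b (t + dl b t) = - dl b t)
  (DnR : forall b t, R b t -> D b t = false)
  (minvD : forall b t, D b t -> minv (dl b t) = Some (b, t))
  (minvP : forall d b t, minv d = Some (b, t) -> D b t /\ dl b t = d).
Hypothesis minv_pg : forall x, minv (pg x - x) = None.
Let m (x x' : G) := ~~ minv (x' - x).
Hypothesis (m_cp : forall x x' y, x != x' -> m y (cp x x' y) = m x x').
Local Notation L := (S + option bool * G)%type.
Local Notation pi := (@group_pi S (option bool) G ps pg).

(** A difference 0 would put [t] in both [D b] and [R b]. *)
Lemma minv0 : minv 0 = None.
Proof.
case e: minv => [[b t]|//]; have [Dt dt] := minvP e.
by have [Rt _] := D_R Dt; rewrite dt addr0 in Rt; rewrite (DnR Rt) in Dt.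
Qed.

Lemma ret_triple_paired u x x' i l y : paired u = Some (x, x', i, l, y) ->
  ret_triple (S := S) D R minv u -> minv (x' - x) /\ generic_pair pg x x'.
Proof.
case: u => [[[//|[j a]] [//|[k b]]] [//|[n c]]] /=.
case: (eqVneq j k) => //= _; case: (eqVneq k n) => //= _.
case: (eqVneq j n) => //= _ [-> -> _ _ _] mi; split=> //.
by apply/andP; split; apply: contraTneq mi => ->; rewrite ?subrr ?minv0 ?minv_pg.
Qed.

Lemma ret_triple_outer u : ret_triple (S := S) D R minv u ->
  reltri pi u /\ outer u.
Proof.
case: u => [[[//|[j a]] [//|[k b]]] [//|[n c]]]; rewrite (outerE None) /=.
have pE (r s : option bool * G) : (inr r == inr s :> L) = (r == s) by [].
rewrite !pE !xpair_eqE.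
by case: (eqVneq j k) => //= jk; case: (eqVneq k n) => //= kn; rewrite ?andbF.
Qed.

Variable h : pred L.
Hypotheses (h_pi : forall a, h (pi a) = h a)
  (h_out : forall u, reltri pi u -> inside h u -> outer u -> two_classes pi (@cross _ _ _) u).

Let P u := (reltri pi u && ~~ inside h u) && outer u.

Lemma ret_tripleP u : ret_triple D R minv u -> P u.
Proof.
move=> ru; have [rl out] := ret_triple_outer ru; rewrite /P rl out andbT /=.
apply/negP => iu; have /(two_classes_paired pg_neq) := h_out rl iu out.
case=> _ [x [x' [i [l [y [e ng]]]]]].
by case: (ret_triple_paired e ru) => _; apply/negP.
Qed.

Lemma block_pairP u : block_pair pg m u -> P u /\ ~~ ret_triple D R minv u.
Proof.
rewrite /block_pair; case e: (paired u) => [[[[[x x'] i] l] y]|//] /andP[g mx].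
have [rl nt] := paired_generic ps e g; have out := paired_outer None e.
split; first by rewrite /P rl out andbT /=; apply: contraNN nt => iu; apply: h_out.
by apply: contraNN mx => /(ret_triple_paired e)[].
Qed.

Lemma double_pairP u : double_pair pg m u ->
  [/\ P u, ~~ ret_triple D R minv u & ~~ block_pair pg m u].
Proof.
have dp : double_pair pg m u -> exists x x' i l y,
    [/\ paired u = Some (x, x', i, l, y), generic_pair pg x x', ~~ m x x'
      & ~~ ret_triple D R minv u].
  case: (u) => [[[//|[j a]] [//|[k b]]] [//|[n c]]] /= /andP[jn].
  case: (eqVneq j k) => /= [?|jk]; first subst k.
    by case/andP=> g mm; rewrite (negPf jn); exists a, b, j, n, c.
  by case/andP=> /eqP<- /andP[g mm]; rewrite eqxx; exists b, c, k, j, a.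
case/dp=> x [x' [i [l [y [e g nm nr]]]]].
have [rl nt] := paired_generic ps e g; have out := paired_outer None e.
rewrite /block_pair e g (negPf nm); split=> //.
by rewrite /P rl out andbT /=; apply: contraNN nt => iu; apply: h_out.
Qed.

Lemma cov_retP : cov (fun u => P u && ret_triple D R minv u).
Proof.
apply: eq_cov (cov_ret_triple S D_R R_D DnR minvD minvP) => u.
by case ru: ret_triple; rewrite ?andbF ?ret_tripleP.
Qed.

Lemma cov_blockP : cov (fun u => (P u && ~~ ret_triple D R minv u) && block_pair pg m u).
Proof.
apply: eq_cov (cov_block_pair S (option bool) cp_l cp_sym cp_neq cp_cp cp_pg m_cp pgK) => u.
by case bu: block_pair; rewrite ?andbF //; have [-> ->] := block_pairP bu.
Qed.

Lemma cov_doubleP : cov (fun u => ((P u && ~~ ret_triple D R minv u)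
  && ~~ block_pair pg m u) && double_pair pg m u).
Proof.
apply: eq_cov (cov_double_pair S (option bool) cp_l cp_sym cp_neq cp_cp cp_pg
  m_cp lt_total pgK) => u.
by case du: double_pair; rewrite ?andbF //; have [-> -> ->] := double_pairP du.
Qed.

Let rest u := ((P u && ~~ ret_triple D R minv u) && ~~ block_pair pg m u)
  && ~~ double_pair pg m u.

(** What is left are two-orbit triples, and unpaired triples whose sum lies outside the domain of
    the matching or which contain an extra letter. *)
Lemma cov_rest : cov rest -> cov P.
Proof.
move=> cr; apply: cov_split cov_retP _.
by apply: cov_split cov_blockP _; apply: cov_split cov_doubleP cr.
Qed.

Lemma rest_paired u x x' i l y : paired u = Some (x, x', i, l, y) ->
  rest u = P u && ~~ generic_pair pg x x'.
Proof.
move=> e; rewrite /rest; case Pu: (P u) => //=.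
have rp := @ret_triple_paired _ _ _ _ _ _ e.
case g: (generic_pair pg x x') rp => rp /=; last first.
  rewrite /block_pair e g /= andbT; apply/andP; split.
    by apply/negP => /rp[].
  move: e g; case: (u) => [[[//|[j a]] [//|[k b]]] [//|[n c]]] /=.
  case: (eqVneq j k) => [?|jk]; case: (eqVneq k n) => [?|kn]; subst => //=.
  - by case=> -> -> _ _ _ ->; rewrite andbF.
  - by case=> -> -> _ _ _ ->; rewrite andbF.
  - by rewrite andbF.
rewrite /block_pair e g /=; move: e g {rp}.
case: (u) => [[[//|[j a]] [//|[k b]]] [//|[n c]]] /=.
case: (eqVneq j k) => [?|jk]; case: (eqVneq k n) => [?|kn]; subst => //=; rewrite ?eqxx //=.
- by case=> <- <- _ _ _ ->; rewrite kn; case: (m a b).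
- by case=> <- <- _ _ _ ->; rewrite jk; case: (m b c).
case: (eqVneq j n) => [?|//] [<- <- _ _ _] _; rewrite /m.
by case: (minv (c - a)).
Qed.

Lemma two_classes_rest u : two_classes pi (free_cross h) u =
  rest u && (if paired u is Some _ then true else false).
Proof.
rewrite (system_pred_outer None pg_neq h_pi).
case e: (paired u) => [[[[[x x'] i] l] y]|]; last by rewrite !andbF.
by rewrite (rest_paired e) andbT.
Qed.

Lemma rest_unpaired u : paired u = None ->
  rest u = P u && ~~ ret_triple D R minv u.
Proof.
move=> e; rewrite /rest /block_pair e andbT.
suff -> : double_pair pg m u = false by rewrite andbT.
move: e; case: (u) => [[[//|[j a]] [//|[k b]]] [//|[n c]]] /=.
case: (eqVneq j k) => [?|jk]; case: (eqVneq k n) => [?|kn]; subst => //=;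
  by rewrite ?eqxx ?andbF.
Qed.

Lemma unpaired_inside u : paired u = None -> reltri pi u -> outer u -> inside h u = false.
Proof.
move=> e rl out; apply/negP => iu; have /(two_classes_paired pg_neq) := h_out rl iu out.
by case=> _ [x [x' [i [l [y [e' _]]]]]]; rewrite e in e'.
Qed.

Section Inf.
Variables (e : S -> G) (einv : G -> option S).
Hypotheses (eK : forall s, einv (e s) = Some s) (einvP : forall t s, einv t = Some s -> e s = t).
Hypothesis einvN : forall b t, D b t || R b t = ~~ einv t.

(** By [einvN] the sums outside the domain are exactly those attached to extra letters, so [rest]
    splits into the blocks with an extra letter and the two-orbit triples. *)
Lemma cov_triple_outer : cov P.
Proof.
apply/cov_rest/(cov_split (Q := inf_block einv)).
  apply: eq_cov (cov_inf_block eK einvP) => u.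
  case iu: inf_block; rewrite ?andbF //= andbT.
  have pE (r s : option bool * G) : (inr r == inr s :> L) = (r == s) by [].
  have [pu out] : paired u = None /\ outer u /\ reltri pi u /\ ~~ ret_triple D R minv u.
    move: iu; case: (u) => [[[s|[i x]] [s'|[j y]]] [s''|[l z]]] //=; rewrite (outerE None) /= => ij.
    - by rewrite ij ?pE ?xpair_eqE (negPf ij).
    - by rewrite ij andbF.
    - by rewrite ij ?pE ?xpair_eqE (negPf ij).
    case/and4P: ij => ij jl il es.
    rewrite (negPf ij) (negPf jl) (negPf il) /= einvN negbK es; split=> //; split=> //.
    by rewrite !pE !xpair_eqE (negPf ij) (negPf jl) [l == i]eq_sym (negPf il).
  case: out => out [rl nr].
  by rewrite rest_unpaired // /P rl out nr unpaired_inside.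
apply: eq_cov (cov_free_cross psK ps_neq pgK pg_neq h_pi) => u.
rewrite two_classes_rest; case ru: (rest u) => //=; apply/esym.
case pu: (paired u) => [[[[[x x'] i] l] y]|].
  move: pu; case: (u) => [[[s|[j a]] [s'|[k b]]] [s''|[n c]]] //=.
  by case: (j == k) (k == n) (j == n) => [] [] [].
apply/negbTE; rewrite negbK; move: ru; rewrite rest_unpaired // => /andP[/andP[_ out]].
move: pu out; case: (u) => [[[s|[j a]] [s'|[k b]]] [s''|[n c]]] //=; rewrite (outerE None) //.
case: (eqVneq j k) => [?|jk]; case: (eqVneq k n) => [?|kn]; subst => //=.
case: (eqVneq j n) => //= jn _ _.
by rewrite einvN negbK.
Qed.
End Inf.

Section ThreeOuter.
Variables (hh : G) (bitg : pred G).
Hypotheses (S0 : S -> False) (hh2 : hh + hh = 0) (pgE : forall x, pg x = x + hh).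
Hypotheses (bitg_hh : forall x, bitg (x + hh) = ~~ bitg x).
Hypothesis DRN : forall b t, D b t || R b t = ~~ ((t == 0) || (t == hh)).
Hypothesis h_in : forall u, inside h u -> ~~ outer u.

Let nrm x := if bitg x then x + hh else x.
Let third (a b : L) : L := match a, b with
  | inr (i, x), inr (j, y) => inr (tag3 i j, nrm (- (x + y)))
  | _, _ => a
  end.
Let bit (a : L) := if a is inr (_, x) then bitg x else false.

Lemma nrm_hh x : nrm (x + hh) = nrm x.
Proof. by rewrite /nrm bitg_hh; case: (bitg x); rewrite /= -?addrA ?hh2 ?addr0. Qed.

Lemma nrm_or x : nrm x = x \/ nrm x = x + hh.
Proof. by rewrite /nrm; case: bitg; [right|left]. Qed.

(** Without extra letters the sums 0 and [hh] remain. Modulo [hh], two orbits in different groups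
    determine a third one with total sum 0, and these triples of orbits are the blocks of
    [cov_three_classes], which covers the two-orbit triples at the same time. *)
Lemma cov_three_outer : cov P.
Proof.
have oppr_hh : - hh = hh by apply/eqP; rewrite eq_sym -subr_eq0 opprK hh2.
have tag3C i j : tag3 j i = tag3 i j by case: i j => [[]|] [[]|].
suff C : cov (three_classes pi (@cross _ _ _) third).
  apply/cov_rest/(eq_cov _ C).
  move=> u; have thE : three_classes pi (@cross _ _ _) third u =
      two_classes pi (@cross _ _ _) u || (let: (a, b, c) := u in
       cross a b && ((c == third a b) || (c == pi (third a b)))).
    by case: (u) => [[a b] c]; rewrite /three_classes /two_classes -!orbA.
  have freeE : two_classes pi (free_cross h) u = two_classes pi (@cross _ _ _) u.
    rewrite (two_classes_free h_pi); case tu: two_classes => //=.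
    have [_ [x [x' [i [l [y [e _]]]]]]] := two_classes_paired pg_neq tu.
    by apply: contraTN (paired_outer None e) => /h_in.
  case pu: (paired u) => [[[[[x x'] i] l] y]|].
    have -> : rest u = two_classes pi (@cross _ _ _) u.
      by rewrite -freeE two_classes_rest pu andbT.
    rewrite thE -[RHS]orbF; congr orb; move: pu.
    case: (u) => [[[s|[j a]] [s'|[k b]]] [s''|[n c]]] //=.
    have pE (r s : option bool * G) : (inr r == inr s :> L) = (r == s) by [].
    rewrite !pE !xpair_eqE.
    by case: j k n => [[]|] [[]|] [[]|].
  have tF : two_classes pi (@cross _ _ _) u = false.
    by rewrite -freeE two_classes_rest pu andbF.
  rewrite rest_unpaired // thE tF /=; case out: (outer u); last first.
    rewrite /P out andbF /=; apply/negbTE; move: out pu.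
    case: (u) => [[[s|[j a]] [s'|[k b]]] [s''|[n c]]] //; rewrite (outerE None) //=.
    by case: j k n => [[]|] [[]|] [[]|].
  have -> : P u = reltri pi u.
    by rewrite /P out andbT; case iu: (inside h u); rewrite ?andbT //; case/negP: (h_in iu).
  move: out pu {thE freeE tF}; case: u => [[[s|[i x]] [s'|[j y]]] [s''|[l z]]];
    try (by case: (S0 s)); try (by case: (S0 s')); try (by case: (S0 s'')).
  have pE (r s : option bool * G) : (inr r == inr s :> L) = (r == s) by [].
  rewrite (outerE None) [reltri _ _]/= [cross _ _]/= [third _ _]/= [pi _]/= !pE !xpair_eqE.
  rewrite [ret_triple _ _ _ _]/= DRN pgE.
  rewrite -andb_orr; have -> : (z == nrm (- (x + y))) || (z == nrm (- (x + y)) + hh) =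
      (x + y + z == 0) || (x + y + z == hh).
    have e1 : (z == - (x + y)) = (x + y + z == 0) by rewrite [x + y + z]addrC addr_eq0.
    have e2 : (z == - (x + y) + hh) = (x + y + z == hh).
      by rewrite -(inj_eq (addrI (- (x + y))) (x + y + z)) addKr.
    case: (nrm_or (- (x + y))) => ->; first by rewrite e1 e2.
    by rewrite -addrA hh2 addr0 e1 e2 orbC.
  by case: i j l => [[]|] [[]|] [[]|] //= _; rewrite ?andbF ?andbT ?negbK.
apply: (cov_three_classes (bit := bit)).
- exact: group_piK.
- by case=> [s|[i x]] /=; [case: (S0 s) | rewrite pgE bitg_hh].
- exact: cross_sym.
- exact: cross_pi.
- exact: cross_irr.
- case=> [s|[i x]] [s'|[j y]] //=; try (by case: (S0 s)); try (by case: (S0 s')).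
  by rewrite /nrm; case e: (bitg (- (x + y))); rewrite ?bitg_hh e.
- case=> [s|[i x]] [s'|[j y]] //=; try (by case: (S0 s)); try (by case: (S0 s')).
  by rewrite tag3C [y + x]addrC.
- case=> [s|[i x]] [s'|[j y]] //=; try (by case: (S0 s)); try (by case: (S0 s')).
  rewrite pgE; congr (inr (_, _)); rewrite -(nrm_hh (- (x + y))); congr nrm.
  by rewrite -[hh in RHS]oppr_hh; ring.
- by case=> [s|[i x]] [s'|[j y]] //= ij; case: (i) (j) ij => [[]|] [[]|].
- case=> [s|[i x]] [s'|[j y]] //= ij.
  have -> : tag3 i (tag3 i j) = j by case: (i) (j) ij => [[]|] [[]|].
  have -> : nrm (- (x + nrm (- (x + y)))) = nrm y.
    case: (nrm_or (- (x + y))) => ->; first by congr nrm; ring.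
    by rewrite -(nrm_hh y); congr nrm; rewrite -[hh in RHS]oppr_hh; ring.
  by rewrite pgE /nrm; case: bitg.
Qed.
End ThreeOuter.

End TripleOuter.

(** * Systems up to relabelling *)

Definition flip n (a : 'I_n * bool) := (a.1, ~~ a.2).

Definition hsys h n := system (@flip n) (fun a => a.1 < h).

Section Canonical.
Variables (L : finType) (pi : L -> L) (hole : pred L) (h n : nat).
Hypotheses (piK : involutive pi) (pi_neq : forall a, pi a != a).
Hypotheses (hole_pi : forall a, hole (pi a) = hole a).
Hypotheses (cardL : #|L| = n.*2) (card_hole : #|[pred a | hole a]| = h.*2).

Lemma card_half (bit p : pred L) : (forall a, bit (pi a) = ~~ bit a) ->
  (forall a, p (pi a) = p a) -> #|[pred a | p a]| = (count (fun a => bit a && p a) (enum L)).*2.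
Proof.
move=> bit_pi p_pi; rewrite -sum1_count big_enum_cond /= -sum1_card -addnn.
rewrite (bigID bit) /=; congr (_ + _).
  by apply: eq_bigl => a; rewrite andbC.
rewrite (reindex_inj (inv_inj piK)) /=.
by apply: eq_bigl => a; rewrite unfold_in /= bit_pi p_pi negbK andbC.
Qed.

(** The orbits are numbered with those in the hole first, and [rank_bit] gives the second
    coordinate. *)
Lemma canonical_bij : exists f : L -> 'I_n * bool, exists2 g, cancel f g /\ cancel g f &
  (forall a, f (pi a) = flip (f a)) /\ (forall a, ((f a).1 < h) = hole a).
Proof.
pose bit := rank_bit pi.
have bit_pi a : bit (pi a) = ~~ bit a by apply: rank_bit_pi.
pose Rh := [seq a <- enum L | bit a && hole a].
pose Rn := [seq a <- enum L | bit a && ~~ hole a].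
pose s := Rh ++ Rn.
have szh : size Rh = h.
  by apply: double_inj; rewrite -card_hole (card_half bit_pi) // /Rh size_filter.
have szn : size s = n.
  apply: double_inj; rewrite -cardL size_cat szh doubleD -card_hole -(cardC hole).
  congr (_ + _); rewrite /Rn size_filter.
  rewrite -(card_half bit_pi (p := predC hole)) //.
  by move=> a; rewrite /= hole_pi.
have sP a : a \in s -> bit a.
  by rewrite mem_cat !mem_filter => /orP[] /andP[/andP[]].
have us : uniq s.
  rewrite cat_uniq (filter_uniq _ (enum_uniq L)) (filter_uniq _ (enum_uniq L)) andbT /=.
  apply/hasPn => a; rewrite !mem_filter => /andP[/andP[_ na] _].
  by rewrite (negPf na) andbF.
have st : size s == n by apply/eqP.
pose g (p : 'I_n * bool) := let r := tnth (Tuple st) p.1 in if p.2 then r else pi r.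
have bit_g p : bit (g p) = p.2.
  rewrite /g; case: p => i [] /=; rewrite ?bit_pi sP //; exact: mem_tnth.
have g_flip p : g (flip p) = pi (g p) by case: p => i []; rewrite /g /= ?piK.
have gI : injective g.
  move=> p p' e; have e2 : p.2 = p'.2 by rewrite -!bit_g e.
  case: p p' e e2 => i b [i' b'] e /= e2; subst b'; congr (_, _).
  have {}e : tnth (Tuple st) i = tnth (Tuple st) i'.
    by case: b e => // /(inv_inj piK).
  by move/(tuple_uniqP (Tuple st)): us; apply.
have [f gK fK] : bijective g.
  apply: inj_card_bij gI _; rewrite cardL card_prod card_ord card_bool; lia.
exists f; exists g => //; split=> [a|a].
  by apply: (can_inj gK); rewrite g_flip !fK.
rewrite -{2}(fK a); case: (f a) => i b.
have -> : hole (g (i, b)) = hole (tnth (Tuple st) i).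
  by rewrite /g; case: b => //=; rewrite hole_pi.
rewrite (tnth_nth a) /= /s nth_cat szh; case: ltnP => ih.
  by have := mem_nth a (s := Rh) (n := i); rewrite szh ih mem_filter => /(_ isT)/andP[/andP[]].
have := mem_nth a (s := Rn) (n := i - h); rewrite mem_filter.
have -> : i - h < size Rn.
  have := ltn_ord i; move: szn; rewrite size_cat szh; lia.
by move=> /(_ isT)/andP[/andP[_ /negbTE]].
Qed.

Lemma hsysE : system pi hole <-> hsys h n.
Proof.
have [f [g [fK gK] [fpi fh]]] := canonical_bij; split.
  exact: (system_bij fK gK fpi fh).
apply: (system_bij gK fK) => [a|a]; last by rewrite -fh gK.
by apply: (can_inj fK); rewrite fpi !gK.
Qed.
End Canonical.

(** * 1-factorizations of complete graphs *)

Section Factorizations.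
Variables (F : zmodType) (n : nat).
Local Open Scope ring_scope.
Hypothesis Fn : forall x : F, x *+ n.*2.+1 = 0.

Definition half (x : F) := x *+ n.+1.

Lemma half_add (x : F) : half x + half x = x.
Proof.
by rewrite /half -mulrnDr addnS addSn addnn mulrS Fn addr0.
Qed.

Lemma half_double (x : F) : half (x + x) = x.
Proof. by rewrite /half mulrnDl half_add. Qed.

Lemma addrr_inj (x y : F) : x + x = y + y -> x = y.
Proof. by move=> e; rewrite -(half_double x) e half_double. Qed.

(** The classical 1-factorization of the complete graph on an abelian group of odd exponent with one
    added point [None]. *)
Definition star_color (a b : option F) : F := match a, b with
  | Some x, Some y => x + y | Some x, None | None, Some x => x + x | None, None => 0 end.
Definition star_mate c (a : option F) : option F := match a with
  | Some x => if x + x == c then None else Some (c - x) | None => Some (half c) end.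

Lemma star_color_sym a b : star_color a b = star_color b a.
Proof. by case: a b => [x|] [y|] //=; rewrite addrC. Qed.

Lemma star_mate_color a b : a != b -> star_mate (star_color a b) a = b.
Proof.
case: a b => [x|] [y|] ab; rewrite /= ?eqxx ?half_double //.
case: (eqVneq x y) ab => [->|xy _]; first by rewrite eqxx.
by rewrite (inj_eq (addrI x)) (negPf xy) addrC addKr.
Qed.

Lemma star_mate_neq c a : star_mate c a != a.
Proof.
case: a => [x|] //=; case: (eqVneq (x + x) c) => // e.
by apply: contra_neq e => - [/eqP]; rewrite subr_eq => /eqP->.
Qed.

Lemma star_color_mate c a : star_color a (star_mate c a) = c.
Proof.
case: a => [x|] /=; last exact: half_add.
by case: eqP => //= _; rewrite addrC subrK.
Qed.

(** A 1-factorization on two copies of [F]. The class [inl g] joins points of the same copy with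
    midpoint [g], and the two copies of [g]; [inr d] joins [(false, x)] to [(true, x + d)]. The
    value [inr 0] is no colour, as its edges are distributed among the classes [inl]. *)
Definition prism_color (a b : bool * F) : F + F :=
  if a.1 == b.1 then inl (half (a.2 + b.2)) else
  if a.2 == b.2 then inl a.2 else inr (if a.1 then a.2 - b.2 else b.2 - a.2).
Definition prism_mate (c : F + F) (a : bool * F) : bool * F := match c with
  | inl g => if a.2 == g then (~~ a.1, a.2) else (a.1, g + g - a.2)
  | inr d => (~~ a.1, if a.1 then a.2 - d else a.2 + d) end.

Lemma prism_color_sym a b : prism_color a b = prism_color b a.
Proof.
case: a b => [p x] [p' y]; rewrite /prism_color /= [p' == p]eq_sym [y == x]eq_sym.
case: eqP => [_|pp]; first by rewrite addrC.
by case: eqP => [->//|_]; case: p p' pp => [] [].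
Qed.

Lemma prism_mate_color a b : a != b -> prism_mate (prism_color a b) a = b.
Proof.
case: a b => [p x] [p' y]; rewrite /prism_color /=.
case: (eqVneq p p') => [<-|pp] ab /=.
  case: eqP => [e|_]; last by rewrite half_add addrC addKr.
  have /addrI e2 : x + x = x + y by rewrite {1 2}e half_add.
  by case/eqP: ab; rewrite e2.
case: (eqVneq x y) => [<-|xy] /=; first by rewrite eqxx; case: p p' pp {ab} => [] [].
by case: p p' pp {ab} => [] [] //= _; rewrite ?subKr // addrC subrK.
Qed.

Lemma prism_mate_neq c a : prism_mate c a != a.
Proof.
case: a c => [p x] [g|d] /=; last by rewrite xpair_eqE; case: p.
case: (eqVneq x g) => [_|xg]; rewrite xpair_eqE; first by case: p.
by rewrite eqxx /= subr_eq; apply: contra_neqN xg => /eqP/addrr_inj->.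
Qed.

Lemma prism_color_mate c a : c != inr 0 -> prism_color a (prism_mate c a) = c.
Proof.
case: a c => [p x] [g|d] cN; rewrite /prism_color /=.
  case: (eqVneq x g) => [->|_] /=; first by case: p; rewrite /= eqxx.
  by rewrite eqxx [x + _]addrC subrK half_double.
have d0 : d != 0 by apply: contraNneq cN => ->.
have e1 : (x == x - d) = false.
  by rewrite -[x in X in X == _]addr0 (inj_eq (addrI x)) eq_sym oppr_eq0 (negPf d0).
have e2 : (x == x + d) = false.
  by rewrite -[x in X in X == _]addr0 (inj_eq (addrI x)) eq_sym (negPf d0).
by case: p => /=; rewrite ?e1 ?e2; congr inr; [rewrite subKr | rewrite addrC addKr].
Qed.

Lemma prism_color_neq a b : prism_color a b != inr 0.
Proof.
rewrite /prism_color; case: ifP => // _; case: ifP => // /negbT ab.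
by apply: contraNneq ab => - [] /eqP; case: ifP => _; rewrite subr_eq0 // eq_sym.
Qed.

End Factorizations.

Lemma val_addZ m (x y : 'I_m.+1) :
  (x + y)%R = (if x + y < m.+1 then x + y else x + y - m.+1) :> nat.
Proof.
have -> : (x + y)%R = (x + y) %% m.+1 :> nat by [].
have ltx := ltn_ord x; have lty := ltn_ord y; case: ltnP => [/modn_small//|xy].
by rewrite -[in LHS](subnK xy) modnDr modn_small //; lia.
Qed.

Lemma val_oppZ m (x : 'I_m.+1) :
  (- x)%R = (if x == 0 :> nat then 0 else m.+1 - x) :> nat.
Proof.
have -> : (- x)%R = (m.+1 - x) %% m.+1 :> nat by [].
have := ltn_ord x; case: eqP => [->|]; first by rewrite subn0 modnn.
by move=> x0 ltx; rewrite modn_small //; lia.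
Qed.

Lemma val_subZ m (x y : 'I_m.+1) :
  (x - y)%R = (if y <= x then x - y else x + m.+1 - y) :> nat.
Proof.
have ltx := ltn_ord x; have lty := ltn_ord y; rewrite val_addZ val_oppZ.
move: (x : nat) (y : nat) ltx lty => a b la lb.
by case: (eqVneq b 0) => ?; repeat (case: ifP => ?); lia.
Qed.

Lemma ord_mulrn_card m (x : 'I_m.+1) : (x *+ m.+1 = 0)%R.
Proof. by apply: val_inj; rewrite Zp_mulrn /= modnMl. Qed.

Section Factorization.
Variable (G : eqType).
Implicit Types (cp : G -> G -> G -> G) (x y : G).

(* [cp x x' y] is the partner of [y] in the colour class of the edge [x x']
   of a 1-factorization of the complete graph. *)
Definition factorization cp := [/\ forall x x', x != x' -> cp x x' x = x',
  forall x x' y, x != x' -> cp x' x y = cp x x' y,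
  forall x x' y, x != x' -> cp x x' y != y &
  forall x x' y z, x != x' -> cp y (cp x x' y) z = cp x x' z].

Lemma factorization_of (V C : eqType) (f : G -> V) (g : V -> G)
    (color : V -> V -> C) (mate : C -> V -> V) :
  cancel f g -> cancel g f ->
  (forall a b, color a b = color b a) ->
  (forall a b, a != b -> mate (color a b) a = b) ->
  (forall a b c, a != b -> mate (color a b) c != c) ->
  (forall a b c, a != b -> color c (mate (color a b) c) = color a b) ->
  factorization (fun x x' y => g (mate (color (f x) (f x')) (f y))).
Proof.
move=> fK gK sym ml mn mc; have fI := can_inj fK.
split=> [x x' ne|x x' y _|x x' y ne|x x' y z ne]; first by rewrite ml ?fK ?(inj_eq fI).
- by rewrite sym.
- by rewrite -(inj_eq fI) gK mn ?(inj_eq fI).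
by rewrite gK mc ?(inj_eq fI).
Qed.

Lemma factorization_eq cp pg x x' y : factorization cp ->
  (forall x y, cp x (pg x) y = pg y) -> x != x' -> (cp x x' y == pg y) = (x' == pg x).
Proof.
case=> cp_l _ _ cp_cp cp_pg ne; apply/eqP/eqP => [e|->//].
by rewrite -(cp_l _ _ ne) -(cp_cp x x' y) // e cp_pg.
Qed.
End Factorization.

Section Star.
Variable n : nat.
Local Notation F := 'I_n.*2.+1.
Local Notation G := 'I_n.*2.+2.

Definition antipode : G := inord n.+1.

Lemma val_antipode : antipode = n.+1 :> nat. Proof. by rewrite inordK //; lia. Qed.

Lemma antipode2 : (antipode + antipode = 0)%R.
Proof. by apply: ord_inj; rewrite val_addZ val_antipode /=; case: ltnP; lia. Qed.

(** The labels make the antipodal matching the class of colour 0: for [0 < x <= n] the antipode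
    [x + n + 1] is sent to [3n + 2 - (x + n + 1)], which is [- x] modulo [2n + 1], and the antipode
    of 0 to [None]. *)
Definition to_star (x : G) : option F :=
  if x < n.+1 then Some (inord x) else
  if x == n.+1 :> nat then None else Some (inord (3 * n + 2 - x)).
Definition of_star (a : option F) : G :=
  if a is Some a then inord (if a < n.+1 then a : nat else 3 * n + 2 - a) else antipode.

Lemma to_starK : cancel to_star of_star.
Proof.
move=> x; apply: ord_inj; rewrite /to_star; have ltx := ltn_ord x.
case: (ltnP x n.+1) => [lx|lx]; rewrite /of_star.
  by rewrite [in X in if X < _ then _ else _]inordK ?lx ?inordK //; lia.
case: (eqVneq (x : nat) n.+1) => [->|ne]; first by rewrite val_antipode.
have e : (inord (3 * n + 2 - x) : F) = 3 * n + 2 - x :> nat by rewrite inordK //; lia.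
have -> : (inord (3 * n + 2 - x) : F) < n.+1 = false by rewrite e; lia.
by rewrite e inordK; lia.
Qed.

Lemma of_starK : cancel of_star to_star.
Proof.
case=> [a|]; rewrite /to_star /= ?val_antipode ?ltnn ?eqxx //.
have := ltn_ord a => lta; rewrite inordK; last by case: (ltnP a n.+1) => ?; lia.
case: (ltnP a n.+1) => [la|la]; first by rewrite la inord_val.
rewrite !ifN; try lia.
congr Some; apply: ord_inj; rewrite inordK /=; lia.
Qed.

Definition star_cp (x x' y : G) :=
  of_star (star_mate n (star_color (to_star x) (to_star x')) (to_star y)).

Lemma star_factorization : factorization star_cp.
Proof.
have Fn := @ord_mulrn_card n.*2.
apply: (factorization_of to_starK of_starK) => *.
- exact: star_color_sym.
- exact: (star_mate_color Fn).
- exact: star_mate_neq.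
- exact: (star_color_mate Fn).
Qed.

Lemma star_color_antipode x :
  star_color (to_star x) (to_star (x + antipode)%R) = 0%R.
Proof.
have Fval (a b : F) : (a + b : nat) = 0 \/ (a + b : nat) = n.*2.+1 -> (a + b = 0)%R.
  by move=> e; apply: ord_inj; rewrite val_addZ /=; case: ltnP; lia.
have ltx := ltn_ord x; rewrite /to_star val_addZ val_antipode.
case: (ltnP (x + n.+1) n.*2.+2) => c1.
- have -> : x < n.+1 by lia.
  rewrite [x + _ < _]ltnNge leq_addl /=; case: eqP => e.
    by apply: Fval; left; rewrite inordK; lia.
  by apply: Fval; right; rewrite !inordK; lia.
- rewrite (_ : x < n.+1 = false); last by lia.
  rewrite (_ : x + n.+1 - n.*2.+2 < n.+1); last by lia.
  case: eqP => e.
    by apply: Fval; left; rewrite inordK; lia.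
  by apply: Fval; right; rewrite !inordK; lia.
Qed.

Lemma star_cp_antipode x y : star_cp x (x + antipode)%R y = (y + antipode)%R.
Proof.
have [l _ _ _] := star_factorization.
rewrite -[RHS](l y (y + antipode)%R) /star_cp ?star_color_antipode //.
apply/eqP => /(congr1 (@nat_of_ord _)); rewrite val_addZ val_antipode.
by have lty := ltn_ord y; case: ltnP => ? ?; lia.
Qed.
End Star.

Section Prism.
Variable j : nat.
Local Notation F := 'I_j.*2.+1.
Local Notation G := 'I_j.*2.*2.+2.

(** Modulo [4j + 2] the point [(false, f)] is [2f] and [(true, f)] is [2f + 3], so the class [inr d]
    has differences [2d + 3] up to sign, and the difference 3 goes to the classes [inl]. With this
    shift 1, - 1 and, for [j > 1], the antipodal difference [2j + 1] belong to classes [inr]. *)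
Definition to_prism (x : G) : bool * F :=
  (odd x, inord (if odd x then if x == 1 :> nat then j.*2 else (x - 3)./2 else x./2)).
Definition of_prism (a : bool * F) : G :=
  inord (if a.1 then if a.2 == j.*2 :> nat then 1 else a.2.*2 + 3 else a.2.*2).

Lemma val_of_prismF f : of_prism (false, f) = f.*2 :> nat.
Proof. by have ltf := ltn_ord f; rewrite inordK //=; lia. Qed.

Lemma val_of_prismT f : of_prism (true, f) =
  (if f == j.*2 :> nat then 1 else f.*2 + 3) :> nat.
Proof.
by have ltf := ltn_ord f; rewrite inordK //=; case: (eqVneq (f : nat) j.*2) => ?; lia.
Qed.

Lemma to_prismK : cancel to_prism of_prism.
Proof.
move=> x; apply: ord_inj; rewrite /to_prism; have ltx := ltn_ord x.
have e := odd_double_half x; case: (odd x) e => e.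
  rewrite val_of_prismT; case: (eqVneq (x : nat) 1) => [x1|x1]; first by rewrite inordK ?eqxx.
  rewrite inordK; last lia.
  by rewrite ifN; lia.
by rewrite val_of_prismF inordK; lia.
Qed.

Lemma of_prismK : cancel of_prism to_prism.
Proof.
case=> - [] f; rewrite /to_prism ?val_of_prismT ?val_of_prismF; have ltf := ltn_ord f.
  case: (eqVneq (f : nat) j.*2) => [e|e].
    by congr (_, _); apply: ord_inj; rewrite inordK.
  have -> : odd (f.*2 + 3) by lia.
  congr (_, _); apply: ord_inj; rewrite ifN; last by lia.
  by rewrite inordK; lia.
by rewrite odd_double; congr (_, _); apply: ord_inj; rewrite inordK; lia.
Qed.

Definition prism_cp (x x' y : G) :=
  of_prism (prism_mate (prism_color j (to_prism x) (to_prism x')) (to_prism y)).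

Lemma prism_factorization : factorization prism_cp.
Proof.
have Fn := @ord_mulrn_card j.*2.
apply: (factorization_of to_prismK of_prismK) => *.
- exact: prism_color_sym.
- exact: (prism_mate_color Fn).
- exact: (prism_mate_neq Fn).
- by apply: (prism_color_mate Fn); apply: prism_color_neq.
Qed.

Definition prism_class (c : F + F) (x : G) : G := of_prism (prism_mate c (to_prism x)).

Section PrismClass.
Variable c : F + F.
Hypothesis c0 : c != inr 0%R.

Lemma prism_classK : involutive (prism_class c).
Proof.
have Fn := @ord_mulrn_card j.*2.
move=> x; rewrite /prism_class of_prismK.
set a := to_prism x; have e := prism_color_mate Fn a c0.
by rewrite -{1}e prism_color_sym (prism_mate_color Fn) ?(prism_mate_neq Fn) ?to_prismK.
Qed.

Lemma prism_class_neq x : prism_class c x != x.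
Proof.
have Fn := @ord_mulrn_card j.*2.
by rewrite -(inj_eq (can_inj to_prismK)) of_prismK (prism_mate_neq Fn).
Qed.

Lemma prism_cp_class x y : prism_cp x (prism_class c x) y = prism_class c y.
Proof.
have Fn := @ord_mulrn_card j.*2.
by rewrite /prism_cp of_prismK (prism_color_mate Fn).
Qed.
End PrismClass.

Local Open Scope ring_scope.

Lemma of_prismB b (f f' : F) : of_prism (b, f') - of_prism (false, f) = of_prism (b, f' - f).
Proof.
have lf := ltn_ord f; have lf' := ltn_ord f'; apply: ord_inj; rewrite val_subZ.
case: b; rewrite ?val_of_prismT !val_of_prismF val_subZ;
  move: (f : nat) (f' : nat) lf lf' => a a' la la'.
  case: (eqVneq a' j.*2) => ?; case: (leqP a a') => ?; repeat (case: ifP => ?); lia.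
by repeat (case: ifP => ?); lia.
Qed.

Lemma of_prismBT (f f' : F) : of_prism (true, f') - of_prism (true, f) = of_prism (false, f' - f).
Proof.
have lf := ltn_ord f; have lf' := ltn_ord f'; apply: ord_inj.
rewrite val_subZ !val_of_prismT val_of_prismF val_subZ.
move: (f : nat) (f' : nat) lf lf' => a a' la la'.
case: (eqVneq a' j.*2) => ?; case: (eqVneq a j.*2) => ?; repeat (case: ifP => ?) => /=; lia.
Qed.

Section Diff.
Variables (U : pred G) (u0 : bool).
Hypotheses (U_opp : forall d, U (- d) = U d)
  (U_even : forall f, f != 0 -> U (of_prism (false, f)) = u0)
  (U_mid : U (of_prism (true, 0)) = u0).

(** Membership of a difference in [U] depends on the colour only: a class [inr] has one difference
    up to sign, and a class [inl] mixes nonzero even differences with 3 or - 3, all of which have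
    status [u0]. *)
Lemma prism_diff x x' : x != x' -> U (x' - x) =
  if prism_color j (to_prism x) (to_prism x') is inr f then U (of_prism (true, f)) else u0.
Proof.
rewrite -{2}(to_prismK x) -{2}(to_prismK x') -(inj_eq (can_inj to_prismK)).
case: (to_prism x) (to_prism x') => [b f] [b' f']; rewrite /prism_color xpair_eqE /=.
case: (eqVneq b b') => [<-|bb] /= ne.
  have ne' : f' - f != 0 by rewrite subr_eq0 eq_sym.
  by case: b; rewrite ?of_prismBT ?of_prismB U_even.
case: (eqVneq f f') => [<-|_].
  by case: b b' bb {ne} => [] [] // _; rewrite -?[_ - of_prism (true, _)]opprB ?U_opp of_prismB subrr.
by case: b b' bb {ne} => [] [] // _; rewrite -?[_ - of_prism (true, _)]opprB ?U_opp of_prismB.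
Qed.

Lemma prism_diff_cp x x' y : x != x' -> U (prism_cp x x' y - y) = U (x' - x).
Proof.
have Fn := @ord_mulrn_card j.*2.
move=> ne; have [_ _ neq _] := prism_factorization.
rewrite !prism_diff // 1?eq_sym ?neq // of_prismK (prism_color_mate Fn) //.
exact: prism_color_neq.
Qed.

Lemma prism_diff_class c x : c != inr 0 -> U (prism_class c x - x) =
  if c is inr f then U (of_prism (true, f)) else u0.
Proof.
have Fn := @ord_mulrn_card j.*2.
move=> c0; rewrite prism_diff 1?eq_sym ?prism_class_neq //.
by rewrite of_prismK (prism_color_mate Fn).
Qed.
End Diff.
End Prism.

(** * From oriented matchings to the outer triples of three groups *)

Section Nest.
Variables (S : finType) (G : finComNzRingType) (ps : S -> S) (pg : G -> G).
Variables (cp : G -> G -> G -> G) (lt : rel G).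
Hypotheses (psK : involutive ps) (ps_neq : forall s, ps s != s).
Hypotheses (pgK : involutive pg) (pg_neq : forall x, pg x != x).
Hypotheses (cpF : factorization cp) (cp_pg : forall x y, cp x (pg x) y = pg y).
Hypothesis (lt_total : forall x y, x != y -> lt y x = ~~ lt x y).
Variables (nS : pred G) (tau : bool -> G -> G) (o : bool -> pred G) (U : pred G).
Local Open Scope ring_scope.
Hypotheses (nS_tau : forall b t, nS t -> nS (tau b t))
  (tauK : forall b t, nS t -> tau b (tau b t) = t)
  (o_tau : forall b t, nS t -> o b (tau b t) = ~~ o b t)
  (dl_inj : forall b t b' t', nS t -> o b t -> nS t' -> o b' t' ->
     tau b t - t = tau b' t' - t' -> b = b' /\ t = t')
  (U_dl : forall b t, nS t -> o b t -> ~~ U (tau b t - t))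
  (U_surj : forall d, ~~ U d -> exists b t, [/\ nS t, o b t & tau b t - t = d])
  (U_pg : forall x, U (pg x - x))
  (U_cp : forall x x' y, x != x' -> U (cp x x' y - y) = U (x' - x)).
Local Notation L := (S + option bool * G)%type.
Local Notation pi := (@group_pi S (option bool) G ps pg).

(** [o b] orients the edges of the matching [tau b]: [D b] holds the sources and [R b] the targets.
    Over both values of [b] the differences of the oriented edges run once through the complement of
    [U]. *)
Let D b t := nS t && o b t.
Let R b t := nS t && ~~ o b t.
Let dl b t := tau b t - t.
Let minv d := [pick p : bool * G | D p.1 p.2 && (dl p.1 p.2 == d)].

Lemma nest_minvE d : minv d = ~~ U d :> bool.
Proof.
rewrite /minv; case: pickP => [[b t] /= /andP[/andP[St ot] /eqP<-]|none].
  by rewrite (U_dl St ot).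
apply/esym/negbTE/negP => Ud; have [b [t [St ot e]]] := U_surj Ud.
by have := none (b, t); rewrite /D /dl /= St ot e eqxx.
Qed.

Lemma nest_DR b t : D b t || R b t = nS t.
Proof. by rewrite /D /R; case: (o b t); rewrite ?andbT ?andbF ?orbF. Qed.

Lemma nest_D_R b t : D b t -> R b (t + dl b t) /\ dl b (t + dl b t) = - dl b t.
Proof.
by case/andP=> St ot; rewrite /R /dl addrC subrK nS_tau // o_tau // ot tauK // opprB.
Qed.

Lemma nest_R_D b t : R b t -> D b (t + dl b t) /\ dl b (t + dl b t) = - dl b t.
Proof.
by case/andP=> St ot; rewrite /D /dl addrC subrK nS_tau // o_tau // ot tauK // opprB.
Qed.

Lemma nest_DnR b t : R b t -> D b t = false.
Proof. by case/andP=> St /negPf ot; rewrite /D ot andbF. Qed.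

Lemma nest_minvD b t : D b t -> minv (dl b t) = Some (b, t).
Proof.
case/andP=> St ot; rewrite /minv; case: pickP => [[b' t'] /= /andP[/andP[St' ot'] /eqP]|none].
  by case/dl_inj=> // -> ->.
by have := none (b, t); rewrite /D /= St ot eqxx.
Qed.

Lemma nest_minvP d b t : minv d = Some (b, t) -> D b t /\ dl b t = d.
Proof. by rewrite /minv; case: pickP => // - [b' t'] /= /andP[Dt /eqP e] [<- <-]. Qed.

Lemma nest_minv_pg x : minv (pg x - x) = None.
Proof. by have := nest_minvE (pg x - x); rewrite U_pg; case: minv. Qed.

Lemma nest_m_cp x x' y : x != x' -> ~~ minv (cp x x' y - y) = ~~ minv (x' - x).
Proof. by move=> ne; rewrite !nest_minvE U_cp. Qed.

Variable h : pred L.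
Hypotheses (h_pi : forall a, h (pi a) = h a)
  (h_out : forall u, reltri pi u -> inside h u -> outer u -> two_classes pi (@cross _ _ _) u).
Let P u := (reltri pi u && ~~ inside h u) && outer u.

Lemma nest_triple_outer (e : S -> G) : injective e ->
  (forall s, nS (e s) = false) -> (forall t, ~~ nS t -> exists s, e s = t) -> cov P.
Proof.
case: cpF => cp_l cp_sym cp_neq cp_cp eI nSe Se.
pose einv t := [pick s | e s == t].
apply: (cov_triple_outer psK ps_neq pgK pg_neq cp_l cp_sym cp_neq cp_cp cp_pg lt_total
  nest_D_R nest_R_D nest_DnR nest_minvD nest_minvP nest_minv_pg nest_m_cp h_pi h_out
  (e := e) (einv := einv)).
- by move=> s; rewrite /einv; case: pickP => [s' /eqP/eI->|/(_ s)] //; rewrite eqxx.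
- by move=> t s; rewrite /einv; case: pickP => [s' /eqP<- [->]|].
move=> b t; rewrite nest_DR /einv; case: pickP => [s /eqP<-|none]; first by rewrite nSe.
by apply/negP => /negP/Se[s e1]; have := none s; rewrite e1 eqxx.
Qed.

Lemma nest_three_outer (hh : G) (bitg : pred G) : (S -> False) -> hh + hh = 0 ->
  (forall x, pg x = x + hh) -> (forall x, bitg (x + hh) = ~~ bitg x) ->
  (forall t, nS t = ~~ ((t == 0) || (t == hh))) ->
  (forall u, inside h u -> ~~ outer u) -> cov P.
Proof.
case: cpF => cp_l cp_sym cp_neq cp_cp S0 hh2 pgE bitP nSE h_in.
apply: (cov_three_outer psK pgK pg_neq cp_l cp_sym cp_neq cp_cp cp_pg lt_total
  nest_D_R nest_R_D nest_DnR nest_minvD nest_minvP nest_minv_pg nest_m_cp h_pi h_out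
  S0 hh2 pgE bitP _ h_in).
by move=> b t; rewrite nest_DR nSE.
Qed.
End Nest.

(** Supplies the hypothesis [h_out] for a hole with at most one orbit in each of two groups: an
    outer triple inside it has letters from these two orbits only. *)
Lemma two_pairs_out (S T G : finType) (ps : S -> S) (pg : G -> G) (h : pred (S + T * G))
    (i1 i2 : T) (p : G) : involutive pg ->
  (forall s, h (inl s) = false) ->
  (forall i x, h (inr (i, x)) -> ((i == i1) || (i == i2)) && ((x == p) || (x == pg p))) ->
  forall u, reltri (group_pi ps pg) u -> inside h u -> outer u ->
    two_classes (group_pi ps pg) (@cross S T G) u.
Proof.
move=> pgK hS hp [[[s|[i x]] [s'|[j y]]] [s''|[l z]]]; rewrite /inside ?hS ?andbF // (outerE i1).
move=> rl /and3P[/hp/andP[hi hx] /hp/andP[hj hy] /hp/andP[hl hz]] out.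
have px u v : (u == p) || (u == pg p) -> (v == p) || (v == pg p) -> u = v \/ u = pg v.
  by move=> /orP[] /eqP-> /orP[] /eqP->; rewrite ?pgK; [left|right|right|left].
case/and3P: rl => ab bc _; rewrite /two_classes [cross _ _]/= [cross _ (inr (l, _))]/=.
case: (eqVneq i j) ab out => [<-|ij] ab out.
  case: (eqVneq i l) out => [//|il] _ /=; rewrite andbF !andbT /=.
  by case: (px y x hy hx) ab => ->; rewrite !eqxx ?orbT.
case: (eqVneq j l) bc out => [<-|jl] bc out.
  by case: (px z y hz hy) bc => ->; rewrite /= !eqxx.
have -> : l = i.
  by move: hi hj hl ij jl => /orP[] /eqP-> /orP[] /eqP-> /orP[] /eqP->; rewrite ?eqxx.
by case: (px z x hz hx) => ->; rewrite /= !eqxx ?orbT.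
Qed.

(** * Changing holes and filling groups *)

(** A single orbit contains no triple that has to be covered. *)
Lemma hsys01 n : hsys 0 n -> hsys 1 n.
Proof.
apply: eq_cov => - [[[i x] [j y]] [l z]]; rewrite /inside /= andbT.
case e: [&& i < 1, j < 1 & l < 1]; last by rewrite andbT.
case/and3P: e => i0 j0 l0; have -> : j = i by apply: ord_inj; lia.
have -> : l = i by apply: ord_inj; lia.
by rewrite andbF !xpair_eqE !eqxx; case: x y z => [] [] [].
Qed.

(** A hole of two orbits can always be filled, by the words of [cov_two_classes]. *)
Lemma hsys20 n : hsys 2 n -> hsys 0 n.
Proof.
move=> sys; pose E (a b : 'I_n * bool) := [&& a.1 < 2, b.1 < 2 & a.1 != b.1].
apply: (cov_split (Q := inside (fun a : 'I_n * bool => a.1 < 2))); last first.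
  by apply: eq_cov sys => - [[a b] c]; rewrite /= andbT.
apply: (eq_cov _ (cov_two_classes (pi := @flip n) (bit := snd) (E := E) _ _ _ _ _)).
- move=> [[[i x] [j y]] [l z]]; rewrite /two_classes /E /inside /flip /= andbT.
  have three : i < 2 -> j < 2 -> l < 2 -> i != j -> j != l -> l = i.
    by rewrite -!val_eqE /= => *; apply: ord_inj; lia.
  case: (ltnP i 2) three => i2 three; last by rewrite !andbF.
  case: (ltnP j 2) three => j2 three; last first.
    rewrite !andbF orbF /=; apply/negP => /andP[/eqP[e _] _].
    by move: j2; rewrite e leqNgt i2.
  case: (ltnP l 2) three => l2 three; last first.
    rewrite !andbF /=; apply/negP => /orP[/andP[/eqP[e _] _]|/andP[/orP[]/eqP[e _] _]];
    by move: l2; rewrite e leqNgt ?i2 ?j2.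
  rewrite !xpair_eqE /= [l == i]eq_sym [l == j]eq_sym.
  case: (eqVneq i j) three => [<-|ij] three.
    by case: (eqVneq i l) => [_|_]; case: x y z => [] [] [].
  case: (eqVneq j l) three => [<-|jl] three; last first.
    by rewrite three // eqxx; case: x y z => [] [] [].
  by rewrite (negPf ij); case: x y z => [] [] [].
- by case=> i []. 
- by [].
- by move=> a b; rewrite /E eq_sym andbCA.
- by [].
by move=> a; rewrite /E eqxx !andbF.
Qed.

Lemma card_pred_seq (T : finType) (p : pred T) (s : seq T) :
  uniq s -> (forall a, p a = (a \in s)) -> #|[pred a | p a]| = size s.
Proof. by move=> /card_uniqP <- ps; apply: eq_card => a; rewrite -ps. Qed.

Lemma card_inl (S T : finType) (p : pred (S + T)) :
  (forall a, p a = if a is inl _ then true else false) -> #|[pred a | p a]| = #|S|.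
Proof.
move=> pE; rewrite -(card_codom (@inl_inj S T)); apply: eq_card => a.
rewrite unfold_in /= pE; apply/esym; case: a => [s|t]; first exact: codom_f.
by apply/codomP => - [].
Qed.

Section Fills.
Variables (S T G : finType) (ps : S -> S) (pg : G -> G).
Hypotheses (psK : involutive ps) (ps_neq : forall s, ps s != s).
Hypotheses (pgK : involutive pg) (pg_neq : forall x, pg x != x).

Lemma fill_of_hsys (hole : pred (S + G)) h n :
  (forall a, hole (pair_pi ps pg a) = hole a) ->
  #|S| + #|G| = n.*2 -> #|[pred a | hole a]| = h.*2 -> hsys h n ->
  system (pair_pi ps pg) hole.
Proof.
move=> hole_pi cSG ch; apply: (hsysE _ _ hole_pi _ ch).2.
- by case=> [s|x] /=; rewrite ?psK ?pgK.
- case=> [s|x]; apply/eqP => - [].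
    by move/eqP; rewrite (negPf (ps_neq s)).
  by move/eqP; rewrite (negPf (pg_neq x)).
by rewrite card_sum.
Qed.

Lemma hsys_of_group (hole : pred (S + T * G)) h n :
  (forall a, hole (group_pi ps pg a) = hole a) ->
  #|S| + #|T| * #|G| = n.*2 -> #|[pred a | hole a]| = h.*2 ->
  system (group_pi ps pg) hole -> hsys h n.
Proof.
move=> hole_pi cSG ch; apply: (hsysE _ _ hole_pi _ ch).1.
- exact: group_piK.
- exact: group_pi_neq.
by rewrite card_sum card_prod.
Qed.
End Fills.

Lemma ord_lt_total m (x y : 'I_m) : x != y -> (y < x) = ~~ (x < y).
Proof. by rewrite -val_eqE /=; lia. Qed.

Lemma subZ_spec m (x y : 'I_m.+1) :
  (y <= x /\ (x - y)%R = x - y :> nat) \/ (x < y /\ (x - y)%R = x + m.+1 - y :> nat).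
Proof. by rewrite val_subZ; case: leqP; [left|right]. Qed.

(** * The recursions with 2k and 3k pairs of letters *)

Section Antipode.
Variable n : nat.
Local Notation G := 'I_n.*2.+2.
Local Notation ap := (antipode n).
Local Notation pg := (fun x : G => (x + ap)%R).

Lemma add_antipodeK : involutive pg.
Proof. by move=> x; rewrite -addrA antipode2 addr0. Qed.

Lemma antipode_neq0 : ap != 0%R.
Proof. by rewrite -val_eqE /= val_antipode. Qed.

Lemma add_antipode_neq (x : G) : (x + ap)%R != x.
Proof. by rewrite -[X in _ != X]addr0 (inj_eq (addrI x)) antipode_neq0. Qed.

Definition polar (x : G) := (x == 0%R) || (x == ap).

Lemma polarE x : polar x = (x == 0 :> nat) || (x == n.+1 :> nat).
Proof. by rewrite /polar -!val_eqE /= val_antipode. Qed.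

Lemma polar_add x : polar (x + ap)%R = polar x.
Proof.
have ltx := ltn_ord x; rewrite !polarE val_addZ val_antipode.
by case: (ltnP (x + n.+1) n.*2.+2); lia.
Qed.

(** For distinct points a [polar] difference means an antipodal pair, and these pairs form one
    colour class. *)
Lemma star_polar_cp (x x' y : G) : x != x' ->
  polar (star_cp x x' y - y)%R = polar (x' - x)%R.
Proof.
move=> ne; have F := star_factorization n; have [_ _ cp_neq _] := F.
have pE (a b : G) : polar (a - b)%R = (a == b) || (a == b + ap)%R.
  by rewrite /polar subr_eq0 subr_eq [(ap + b)%R]addrC.
rewrite !pE (factorization_eq _ F (@star_cp_antipode n) ne) (negPf (cp_neq _ _ _ ne)).
by rewrite [x' == x]eq_sym (negPf ne).
Qed.

Lemma polar_mem x : polar x = (x \in [:: 0%R; ap]).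
Proof. by rewrite !inE. Qed.

Lemma polar_uniq : uniq [:: 0%R; ap].
Proof. by rewrite /= inE eq_sym antipode_neq0. Qed.

Lemma polar_fill (S : finType) (ps : S -> S) (hole : pred (S + G)) k :
  involutive ps -> (forall s, ps s != s) -> #|S| + n.*2.+2 = k.*2 ->
  (forall a, hole a = if a is inr x then polar x else false) ->
  hsys 0 k -> system (pair_pi ps pg) hole.
Proof.
move=> psK ps_neq ck hE /hsys01; apply: fill_of_hsys => //.
- exact: add_antipodeK.
- exact: add_antipode_neq.
- by case=> [s|x]; rewrite !hE //= polar_add.
- by rewrite card_ord.
rewrite (card_pred_seq (s := map inr [:: 0%R; ap])) //.
  by rewrite (map_inj_uniq (@inr_inj S G)) polar_uniq.
by case=> [s|x]; rewrite hE ?(mem_map (@inr_inj S G)) ?polar_mem.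
Qed.

(** The new hole is the orbit of 0 in both groups; in each filling this is a hole of one orbit,
    available by [hsys01]. *)
Lemma hsys_double : hsys 0 n.+1 -> hsys 2 n.+1.*2.
Proof.
move=> sys; pose h (a : void + bool * G) := if a is inr (_, x) then polar x else false.
have h_pi a : h (group_pi id pg a) = h a by case: a => [[]|[i x]] /=; apply: polar_add.
have psn (s : void) : id s != s by case: s.
have [cp_l cp_sym cp_neq cp_cp] := star_factorization n.
apply: (hsys_of_group (fun=> erefl) psn add_antipodeK add_antipode_neq (hole := h)) => //.
- by rewrite card_ord card_bool card_void; lia.
- rewrite (card_pred_seq (s := [seq inr (i, x) | i <- [:: true; false], x <- [:: 0%R; ap]])) //.
    by rewrite allpairs_uniq ?polar_uniq // => - [i x] [j y] _ _ [-> ->].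
  case=> [[]|[i x]]; rewrite /h polar_mem; apply/idP/allpairsP => [hx|[[j y] [_ hy [_ ->]]] //].
  by exists (i, x); split=> //; case: (i).
apply: assemble => [[]|i|].
  by apply: (polar_fill _ psn _ _ sys) => //; [rewrite card_void; lia | case].
apply: (cov_double_outer add_antipodeK add_antipode_neq cp_l cp_sym cp_neq cp_cp) => //.
  exact: star_cp_antipode.
apply: (two_pairs_out (i1 := true) (i2 := false) (p := 0%R) add_antipodeK); first by case.
by case=> x; rewrite /h /polar add0r.
Qed.

Section ThreeGroups.
Hypothesis n_even : ~~ odd n.

Let nS (t : G) := ~~ polar t.
(** As [n + 1] is odd, [t <-> - t] yields the nonzero even differences and [t <-> ap - t] the odd
    ones other than [n + 1]. The latter matching preserves both halves of the cycle; [o true]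
    orients them oppositely, so that a difference occurs together with its negative. *)
Let tau b (t : G) := (if b then ap - t else - t)%R.
Let o b (t : G) := if b then (t.*2 < n.+1) || (n.+1 < t) && (n.+1 < (t - n.+1).*2) else t < n.+1.

Lemma three_tau b t : nS t -> if b
  then t < n.+1 /\ tau b t = n.+1 - t :> nat \/ n.+1 < t /\ tau b t = 3 * n.+1 - t :> nat
  else 0 < t /\ tau b t = n.*2.+2 - t :> nat.
Proof.
rewrite /nS polarE /tau => nt; case: b.
  by have := subZ_spec ap t; rewrite val_antipode; lia.
by rewrite val_oppZ ifN; lia.
Qed.

Lemma three_nS_tau b t : nS t -> nS (tau b t).
Proof.
move=> St; have := three_tau b St; have := ltn_ord t; move: St; rewrite /nS !polarE.
by case: b; lia.
Qed.

Lemma three_o_tau b t : nS t -> o b (tau b t) = ~~ o b t.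
Proof.
move=> St; have := three_tau b St; have := ltn_ord t; move: St; rewrite /nS !polarE /o.
by case: b; lia.
Qed.

Lemma three_dl b t : nS t -> o b t -> if b
  then t < n.+1 /\ (tau b t - t)%R = n.+1 - t.*2 :> nat \/
       n.+1 < t /\ (tau b t - t)%R = 5 * n.+1 - t.*2 :> nat
  else (tau b t - t)%R = n.*2.+2 - t.*2 :> nat.
Proof.
move=> St; have := three_tau b St; have := ltn_ord t; have := subZ_spec (tau b t) t.
move: St; rewrite /nS !polarE /o; by case: b; lia.
Qed.

Lemma three_dl_inj b t b' t' : nS t -> o b t -> nS t' -> o b' t' ->
  (tau b t - t = tau b' t' - t')%R -> b = b' /\ t = t'.
Proof.
move=> St ot St' ot' /(congr1 (@nat_of_ord _)).
have := three_dl St ot; have := three_dl St' ot'; have := ltn_ord t; have := ltn_ord t'.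
move: St ot St' ot'; rewrite /nS !polarE /o.
by case: b; case: b' => *; split=> //; try (apply: ord_inj); lia.
Qed.

Lemma three_U_dl b t : nS t -> o b t -> ~~ polar (tau b t - t)%R.
Proof.
move=> St ot; have := three_dl St ot; have := ltn_ord t.
by move: St ot; rewrite /nS !polarE /o; case: b; lia.
Qed.

Lemma three_U_surj (d : G) : ~~ polar d ->
  exists b t, [/\ nS t, o b t & (tau b t - t = d)%R].
Proof.
move=> dP; have ltd := ltn_ord d.
suff [b [v [vM Sv ov dv]]] : exists b v, [/\ v < n.*2.+2, (v != 0) && (v != n.+1),
    o b (inord v) & forall t : G, t = v :> nat -> nS t -> o b t -> (tau b t - t)%R = d :> nat].
  exists b, (inord v); have St : nS (inord v).
    by rewrite /nS polarE inordK // negb_or.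
  by split=> //; apply: ord_inj; apply: dv => //; rewrite inordK.
(* The parity of [d] selects the matching, and each witness solves the formula of [three_dl] for
   [t]. *)
move: dP; rewrite polarE; case od: (odd d) => dP.
  exists true; case: (ltnP d n.+1) => dn.
    exists (n.+1 - d)./2; rewrite /o inordK; last by lia.
    by split; try lia; move=> t tv St ot; have := three_dl (b := true) St ot; lia.
  exists (n.+1 + (3 * n.+1 - d)./2); rewrite /o inordK; last by lia.
  by split; try lia; move=> t tv St ot; have := three_dl (b := true) St ot; lia.
exists false, (n.+1 - d./2); rewrite /o inordK; last by lia.
by split; try lia; move=> t tv St ot; have := three_dl (b := false) St ot; lia.
Qed.

(** The hole lies inside the group with tag [None], so it contains no outer triple; the other two
    groups are filled completely. *)
Lemma hsys_triple h (Hs : seq G) : uniq Hs -> size Hs = h.*2 ->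
  (forall x, (x + ap \in Hs)%R = (x \in Hs)) ->
  hsys h n.+1 -> hsys 0 n.+1 -> hsys h (3 * n.+1).
Proof.
move=> uH sH Hpi sysh sys0.
pose hole (a : void + option bool * G) := if a is inr (None, x) then x \in Hs else false.
have h_pi a : hole (group_pi id pg a) = hole a by case: a => [[]|[[i|] x]] //=; apply: Hpi.
have psn (s : void) : id s != s by case: s.
have hole_in u : inside hole u -> ~~ outer u.
  by case: u => [[[[]|[[?|] x]] [[]|[[?|] y]]] [[]|[[?|] z]]]; rewrite ?(outerE None) //= ?andbF.
apply: (hsys_of_group (fun=> erefl) psn add_antipodeK add_antipode_neq (hole := hole)) => //.
- by rewrite card_ord card_option card_bool card_void; lia.
- have nI : injective (fun x => inr (None, x) : void + option bool * G) by move=> x y [].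
  rewrite (card_pred_seq (s := [seq inr (None, x) | x <- Hs])) ?size_map ?(map_inj_uniq nI) //.
  case=> [[]|[[i|] x]]; rewrite /hole ?(mem_map nI) //.
  by apply/esym/negbTE/mapP => - [].
apply: assemble => [[]|[i|]|].
- apply: (fill_of_hsys (h := 0) (n := n.+1) (fun=> erefl) psn add_antipodeK add_antipode_neq) => //.
  + by case=> [[]|x].
  + by rewrite card_ord card_void; lia.
  by apply: eq_card0 => - [[]|x].
- apply: (fill_of_hsys (h := h) (n := n.+1) (fun=> erefl) psn add_antipodeK add_antipode_neq) => //.
  + by case=> [[]|x] /=; apply: Hpi.
  + by rewrite card_ord card_void; lia.
  rewrite (card_pred_seq (s := map inr Hs)) ?size_map ?(map_inj_uniq (@inr_inj _ _)) //.
  by case=> [[]|x]; rewrite (mem_map (@inr_inj _ _)).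
apply: (nest_three_outer (lt := fun x y : G => x < y) (nS := nS) (tau := tau) (o := o) (U := polar)
  (fun=> erefl) add_antipodeK add_antipode_neq
  (star_factorization n) (@star_cp_antipode n) _ _ _ _ _ _ _ _ _ _ _
  (hh := ap) (bitg := fun x : G => x < n.+1)) => //.
- exact: ord_lt_total.
- exact: three_nS_tau.
- by case=> t _; rewrite /tau ?subKr ?opprK.
- exact: three_o_tau.
- exact: three_dl_inj.
- exact: three_U_dl.
- exact: three_U_surj.
- by move=> x; rewrite addrC addKr /polar eqxx orbT.
- exact: star_polar_cp.
- by move=> u _ iu; rewrite (negPf (hole_in u iu)).
- exact: antipode2.
by move=> x; have ltx := ltn_ord x; rewrite val_addZ val_antipode;
  case: (ltnP (x + n.+1) n.*2.+2); lia.
Qed.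
End ThreeGroups.
End Antipode.

(* The matching of [Z / 2 k], [k = 2 j + e], given by [t <-> - t] in the middle half and by
   [t <-> - 1 - t] outside it; the 2 or 4 points that are not free correspond to the extra
   letters, and [fold_skip] holds for the differences that do not occur. *)
Section Fold.
Variables (m j e : nat).
Hypotheses (mE : m.+2 = 4 * j + 2 * e) (e1 : e <= 1) (j0 : 0 < j).
Local Notation G := 'I_m.+2.

Definition fold_free (t : G) :=
  [&& t != j :> nat, t != 2 * j + e :> nat & (e == 1) ==> (t != 0 :> nat) && (t.+1 != m.+2)].
Definition fold_tau (_ : bool) (t : G) : G :=
  inord (if (t < j) || (3 * j + 2 * e <= t) then m.+1 - t else m.+2 - t).
Definition fold_dir (b : bool) (t : G) := b == (t < fold_tau b t).
Definition fold_skip (d : G) :=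
  [|| d == 0 :> nat, d == 2 * j + e :> nat | (e == 1) && ((d == 1 :> nat) || (d.+1 == m.+2))].

Lemma fold_tau_spec b t : fold_free t ->
  (t < j \/ 3 * j + 2 * e <= t) /\ fold_tau b t = m.+1 - t :> nat \/
  j < t < 3 * j + 2 * e /\ fold_tau b t = m.+2 - t :> nat.
Proof.
have ltt := ltn_ord t; rewrite /fold_free /fold_tau => ft.
by case: ifP => c; rewrite inordK; lia.
Qed.

Lemma fold_free_tau b t : fold_free t -> fold_free (fold_tau b t).
Proof.
move=> ft; have := fold_tau_spec b ft; have := ltn_ord t; move: ft; rewrite /fold_free; lia.
Qed.

Lemma fold_tauK b t : fold_free t -> fold_tau b (fold_tau b t) = t.
Proof.
move=> ft; apply: ord_inj; have := fold_tau_spec b (fold_free_tau b ft).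
have := fold_tau_spec b ft; have := ltn_ord t; move: ft; rewrite /fold_free; lia.
Qed.

Lemma fold_dir_tau b t : fold_free t -> fold_dir b (fold_tau b t) = ~~ fold_dir b t.
Proof.
move=> ft; rewrite /fold_dir fold_tauK //; have := fold_tau_spec b ft.
have := ltn_ord t; move: ft; rewrite /fold_free; lia.
Qed.

Lemma fold_dl_spec b t : fold_free t ->
  [\/ t < j /\ (fold_tau b t - t)%R = m.+1 - t.*2 :> nat,
      3 * j + 2 * e <= t /\ (fold_tau b t - t)%R = m.+1 + m.+2 - t.*2 :> nat,
      j < t < 2 * j + e /\ (fold_tau b t - t)%R = m.+2 - t.*2 :> nat |
      2 * j + e < t < 3 * j + 2 * e /\ (fold_tau b t - t)%R = m.+2.*2 - t.*2 :> nat].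
Proof.
move=> ft; have spec := fold_tau_spec b ft; have sub := subZ_spec (fold_tau b t) t.
have ltt := ltn_ord t; move: ft; rewrite /fold_free => ft.
case: (ltnP t j) => c1; first by constructor 1; lia.
case: (leqP (3 * j + 2 * e) t) => c2; first by constructor 2; lia.
by case: (ltnP t (2 * j + e)) => c3; [constructor 3 | constructor 4]; lia.
Qed.

(** Parity separates the two parts of the matching: the difference is [- 2t] in the middle half and
    [- 1 - 2t] outside. One matching serves both directions, upwards for [b = true] and downwards
    for [b = false]. *)
Lemma fold_dl_inj b t b' t' : fold_free t -> fold_dir b t -> fold_free t' -> fold_dir b' t' ->
  (fold_tau b t - t = fold_tau b' t' - t')%R -> b = b' /\ t = t'.
Proof.
move=> ft ot ft' ot' e0.
suff tt : t = t' by move: ot ot'; rewrite /fold_dir tt => /eqP-> /eqP->.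
apply: ord_inj; move/(congr1 (@nat_of_ord _)): e0; have := ltn_ord t; have := ltn_ord t'.
have := fold_dl_spec b ft; have := fold_dl_spec b' ft'; clear ot ot'.
by move: ft ft'; rewrite /fold_free => ft ft' [] [? ?] [] [? ?]; lia.
Qed.

(** The points [j] and [2j + e] have no partner; for [e = 1] the edge between 0 and - 1 is given up
    as well, which removes the differences 1 and - 1. *)
Lemma fold_skip_dl b t : fold_free t -> fold_dir b t -> ~~ fold_skip (fold_tau b t - t)%R.
Proof.
move=> ft _; have := ltn_ord t; have := fold_dl_spec b ft.
by move: ft; rewrite /fold_free /fold_skip => ft [] [? ?]; lia.
Qed.

Lemma fold_skip_surj (d : G) : ~~ fold_skip d -> exists b t,
  [/\ fold_free t, fold_dir b t & (fold_tau b t - t = d)%R].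
Proof.
move=> dP; have ltd := ltn_ord d.
suff [v vM vP] : exists2 v, v < m.+2 & forall t : G, t = v :> nat ->
    fold_free t /\ (fold_free t -> (fold_tau true t - t)%R = d :> nat).
  have [ft dv] := vP (inord v) (inordK vM).
  exists ((inord v : G) < fold_tau true (inord v)), (inord v : G); split=> //.
    by rewrite /fold_dir eqxx.
  by apply: ord_inj; apply: dv.
move: dP; rewrite /fold_skip => dP.
(* Each of the four witnesses inverts one case of [fold_dl_spec]. *)
case od: (odd d); [case: (ltnP d (2 * j + e)) => c | case: (ltnP d (2 * j + e)) => c].
- exists (m.+1 + m.+2 - d)./2; first lia; move=> t tv.
  by split; [rewrite /fold_free; lia | move=> /(fold_dl_spec true)[] [? ->]; lia].
- exists (m.+1 - d)./2; first lia; move=> t tv.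
  by split; [rewrite /fold_free; lia | move=> /(fold_dl_spec true)[] [? ->]; lia].
- exists (m.+2 - d)./2; first lia; move=> t tv.
  by split; [rewrite /fold_free; lia | move=> /(fold_dl_spec true)[] [? ->]; lia].
- exists (m.+2.*2 - d)./2; first lia; move=> t tv.
  by split; [rewrite /fold_free; lia | move=> /(fold_dl_spec true)[] [? ->]; lia].
Qed.
End Fold.

(** * The recursions with 3k + 1 and 3k + 2 pairs of letters *)

Section Even.
Variable i : nat.
Local Notation n := i.*2.+1.
Local Notation G := 'I_n.*2.+2.
Local Notation ap := (antipode n).
Local Notation pg := (fun x : G => (x + ap)%R).

(** The two extra letters form one orbit, so the fillings need no hole for them; the new hole is the
    orbit of 0 in two of the groups. *)
Lemma hsys_even : hsys 0 n.+2 -> hsys 2 (3 * n.+1).+1.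
Proof.
move=> sys.
pose h (a : bool + option bool * G) := if a is inr (Some _, x) then polar x else false.
have h_pi a : h (group_pi negb pg a) = h a by case: a => [s|[[b|] x]] //=; apply: polar_add.
have psn b : ~~ b != b by case: b.
have mE : n.*2.+2 = 4 * i.+1 + 2 * 0 by lia.
apply: (hsys_of_group negbK psn (@add_antipodeK n) (@add_antipode_neq n) (hole := h)) => //.
- by rewrite card_ord card_option card_bool; lia.
- rewrite (card_pred_seq (s := [seq inr (Some b, x) | b <- [:: true; false], x <- [:: 0%R; ap]])) //.
    by rewrite allpairs_uniq ?polar_uniq // => - [b x] [b' y] _ _ [-> ->].
  case=> [s|[[b|] x]]; rewrite /h ?polar_mem; last by apply/esym/negbTE/allpairsP => - [[? ?] []].
    by apply/esym/negbTE/allpairsP => - [[? ?] []].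
  apply/idP/allpairsP => [hx|[[b' y] [_ hy [_ ->]]] //].
  by exists (b, x); split=> //; case: (b).
apply: assemble => [s s' s''|b|].
- have pE (r r' : bool) : (inl r == inl r' :> bool + option bool * G) = (r == r') by [].
  by rewrite /= !pE; case: s s' s'' => [] [] [].
- case: b => [b|].
    by apply: (polar_fill negbK psn _ _ sys) => //; [rewrite card_bool; lia | case].
  apply: (fill_of_hsys (h := 0) negbK psn (@add_antipodeK n) (@add_antipode_neq n) _ _ _ sys).
  + by case.
  + by rewrite card_bool card_ord; lia.
  by apply: eq_card0 => - [].
(* The two sums without a partner, [k / 2] and [k] for [k = n + 1], are attached to the extra
   letters. *)
pose e (b : bool) : G := if b then inord i.+1 else ap.
have ve b : e b = (if b then i.+1 else i.+1.*2) :> nat.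
  by case: b; rewrite /e ?val_antipode ?inordK //; lia.
apply: (nest_triple_outer (lt := fun x y : G => x < y) (nS := fold_free i.+1 0)
  (tau := fold_tau i.+1 0) (o := fold_dir i.+1 0) (U := fold_skip i.+1 0)
  negbK psn (@add_antipodeK n) (@add_antipode_neq n)
  (star_factorization n) (@star_cp_antipode n) _ _ _ _ _ _ _ _ _ _ _ (e := e)) => //.
- exact: ord_lt_total.
- by move=> b t; apply: fold_free_tau.
- by move=> b t; apply: fold_tauK.
- by move=> b t; apply: fold_dir_tau.
- by move=> b t b' t'; apply: fold_dl_inj.
- by move=> b t; apply: fold_skip_dl.
- by move=> d; apply: fold_skip_surj.
- by move=> x; rewrite addrC addKr /fold_skip val_antipode; lia.
- have sE (d : G) : fold_skip i.+1 0 d = polar d by rewrite polarE /fold_skip; lia.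
  by move=> x x' y ne; rewrite !sE star_polar_cp.
- apply: (two_pairs_out (i1 := Some true) (i2 := Some false) (p := 0%R) (@add_antipodeK n)) => //.
  by move=> [[]|] x //=; rewrite /polar add0r.
- by move=> b b' /(congr1 (@nat_of_ord _)); rewrite !ve; case: b b' => [] [] //; lia.
- by move=> b; rewrite /fold_free ve; case: b; lia.
move=> t; rewrite /fold_free; case: (eqVneq (t : nat) i.+1) => [ti|ti] ft.
  by exists true; apply: ord_inj; rewrite ve.
by exists false; apply: ord_inj; rewrite ve; lia.
Qed.
End Even.

Section Odd.
Variable j : nat.
Local Notation k := j.*2.+1.
Local Notation F := 'I_j.*2.+1.
Local Notation G := 'I_j.*2.*2.+2.
Local Notation S := ('I_2 * bool)%type.

Lemma flipK (n : nat) : involutive (@flip n). Proof. by case=> i []. Qed.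
Lemma flip_neq (n : nat) (s : 'I_n * bool) : flip s != s.
Proof. by case: s => i []; rewrite xpair_eqE andbF. Qed.

Section PrismCore.
Variables (c : F + F) (u0 : bool) (v : S -> nat).
Variables (nS : pred G) (tau : bool -> G -> G) (o : bool -> pred G) (U : pred G).
Local Open Scope ring_scope.
Hypotheses (c0 : c != inr 0) (nS_tau : forall b t, nS t -> nS (tau b t))
  (tauK : forall b t, nS t -> tau b (tau b t) = t)
  (o_tau : forall b t, nS t -> o b (tau b t) = ~~ o b t)
  (dl_inj : forall b t b' t', nS t -> o b t -> nS t' -> o b' t' ->
     tau b t - t = tau b' t' - t' -> b = b' /\ t = t')
  (U_dl : forall b t, nS t -> o b t -> ~~ U (tau b t - t))
  (U_surj : forall d, ~~ U d -> exists b t, [/\ nS t, o b t & tau b t - t = d])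
  (U_opp : forall d, U (- d) = U d)
  (U_even : forall f, f != 0 -> U (of_prism (false, f)) = u0)
  (U_mid : U (of_prism (true, 0)) = u0)
  (U_c : if c is inr f then U (of_prism (true, f)) else u0).
Hypotheses (v_lt : forall s, (v s < j.*2.*2.+2)%N) (v_inj : injective v)
  (nS_v : forall t : G, nS t = [forall s, v s != t]).

(** The four extra letters are the hole of every filling and of the result. The colour class [c]
    serves as the involution on each group, and [v] attaches sums to the extra letters. *)
Lemma hsys_prism : hsys 2 k.+2 -> hsys 2 (3 * k).+2.
Proof.
move=> sys; pose h (a : S + option bool * G) := if a is inl _ then true else false.
pose pg := prism_class c.
have pgK : involutive pg by apply: prism_classK.
have pg_neq x : pg x != x by apply: prism_class_neq.
have psK := @flipK 2; have psn := @flip_neq 2.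
have h_pi a : h (group_pi (@flip 2) pg a) = h a by case: a => [s|[b x]].
have cS : #|{: S}| = 4 by rewrite card_prod card_ord card_bool.
apply: (hsys_of_group psK psn pgK pg_neq (hole := h)) => //.
- by rewrite cS card_ord card_option card_bool; lia.
- by rewrite (card_inl (p := h)) ?cS.
apply: assemble => // [b|].
  apply: (fill_of_hsys psK psn pgK pg_neq _ _ _ sys) => [[]//||].
    by rewrite cS card_ord; lia.
  by rewrite (card_inl (p := h \o embed b)) ?cS //; case.
have ve s : (inord (v s) : G) = v s :> nat by rewrite inordK.
apply: (nest_triple_outer (lt := fun x y : G => (x < y)%N) (nS := nS)
  (tau := tau) (o := o) (U := U) psK psn pgK pg_neq
  (prism_factorization j) _ _ _ _ _ _ _ _ _ _ _ _ (e := fun s => inord (v s))) => //.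
- by move=> x y; apply: prism_cp_class.
- exact: ord_lt_total.
- by move=> x; rewrite (prism_diff_class U_opp U_even U_mid).
- by move=> x x' y; apply: (prism_diff_cp U_opp U_even U_mid).
- by move=> [[[s|[b x]] [s'|[b' y]]] [s''|[b'' z]]] //; rewrite (outerE None).
- by move=> s s' /(congr1 (@nat_of_ord _)); rewrite !ve => /v_inj.
- by move=> s; rewrite nS_v; apply/forallP => /(_ s); rewrite ve eqxx.
move=> t; rewrite nS_v => /forallPn[s]; rewrite negbK => /eqP vs.
by exists s; apply: ord_inj; rewrite ve.
Qed.
End PrismCore.

Lemma four_values (a b d f : nat) (P : pred nat) :
  (forall s : S, P (if s.1 == 0 :> nat then if s.2 then a else b else if s.2 then d else f)) <->
  [/\ P a, P b, P d & P f].
Proof.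
split=> [H|[Pa Pb Pd Pf] [[[|[]] //= _] []] //].
by split; [have := H (ord0, true) | have := H (ord0, false) | have := H (ord_max, true)
  | have := H (ord_max, false)].
Qed.

Definition four (a b d f : nat) (s : S) :=
  if s.1 == 0 :> nat then if s.2 then a else b else if s.2 then d else f.

Lemma four_inj a b d f : uniq [:: a; b; d; f] -> injective (four a b d f).
Proof.
rewrite /= !inE => u [[[|[|x]] // ?] []] [[[|[|y]] // ?] []]; rewrite /four /= => e0;
  try (congr (_, _); exact: ord_inj); exfalso; lia.
Qed.

Lemma hsys_odd : 1 < j -> hsys 2 k.+2 -> hsys 2 (3 * k).+2.
Proof.
move=> j1; have j0 : 0 < j by lia.
have mE : j.*2.*2.+2 = 4 * j + 2 * 1 by lia.
have jF : j.-1 < j.*2.+1 by lia.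
have vj : (inord j.-1 : F) = j.-1 :> nat by rewrite inordK.
(* The class [inr d] with [d = j - 1] has difference [2d + 3 = 2j + 1], so the involution is the
   antipodal one; [d] is not 0 because [j > 1]. The other skipped differences, 1 and - 1, are the
   classes of [d = - 1] and [d = - 2]. *)
apply: (hsys_prism (c := inr (inord j.-1)) (u0 := false) (nS := fold_free j 1)
  (tau := fold_tau j 1) (o := fold_dir j 1) (U := fold_skip j 1)
  (v := four 0 j.*2.*2.+1 j j.*2.+1)).
- by apply/eqP => - [] /(congr1 (@nat_of_ord _)); rewrite vj /=; lia.
- by move=> b t; apply: fold_free_tau.
- by move=> b t; apply: fold_tauK.
- by move=> b t; apply: fold_dir_tau.
- by move=> b t b' t'; apply: fold_dl_inj.
- by move=> b t; apply: fold_skip_dl.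
- by move=> d; apply: fold_skip_surj.
- move=> d; rewrite /fold_skip val_oppZ; have := ltn_ord d.
  by case: (eqVneq (d : nat) 0) => [->//|]; lia.
- move=> f; rewrite -val_eqE /fold_skip val_of_prismF /=; have := ltn_ord f; lia.
- by rewrite /fold_skip val_of_prismT /= ifN; lia.
- by rewrite /fold_skip val_of_prismT vj ifN; lia.
- apply: (four_values _ _ _ _ (fun w => w < j.*2.*2.+2)).2; split; lia.
- by apply: four_inj; rewrite /= !inE; lia.
move=> t; rewrite /fold_free; have ltt := ltn_ord t; apply/esym.
apply/forallP/idP => [H|ft]; last first.
  by apply: (four_values _ _ _ _ (fun w => w != t)).2; split; lia.
by have [] := (four_values _ _ _ _ (fun w => w != t)).1 H; lia.
Qed.
End Odd.

(* For [k = 3] the antipodal matching belongs to no suitable 1-factorization;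
   the involution is the colour class [0 <-> 3], [x <-> - x] instead. *)
Lemma hsys_eleven : hsys 2 5 -> hsys 2 11.
Proof.
(* The matching is the single edge between 0 and 5, with differences 1 and 5; the even differences
   and 3 are left over, whence [u0 = true]. *)
apply: (hsys_prism (j := 1) (c := inl 0%R) (u0 := true)
  (nS := fun t => (t == 0 :> nat) || (t == 5 :> nat)) (tau := fun _ t => inord (5 - t))
  (o := fun b t => b == (t < 3)) (U := fun d => (d == 0 :> nat) || (1 < d < 5))
  (v := four 1 2 3 4)) => //.
- by move=> b t; rewrite inordK; have := ltn_ord t; lia.
- by move=> b t ht; apply: ord_inj; have := ltn_ord t; rewrite !inordK; lia.
- by move=> b t ht; rewrite inordK; have := ltn_ord t; lia.
- move=> b t b' t' ht /eqP-> ht' /eqP-> /(congr1 (@nat_of_ord _)); rewrite !val_subZ.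
  rewrite !inordK; try (have := ltn_ord t; have := ltn_ord t'; lia).
  have [t0|t5] : t = 0 :> nat \/ t = 5 :> nat by lia.
    have [t0'|t5'] : t' = 0 :> nat \/ t' = 5 :> nat by lia.
      by move=> _; split; [rewrite t0 t0' | apply: ord_inj; rewrite t0].
    by rewrite t0 t5'.
  have [t0'|t5'] : t' = 0 :> nat \/ t' = 5 :> nat by lia.
    by rewrite t0' t5.
  by move=> _; split; [rewrite t5 t5' | apply: ord_inj; rewrite t5].
- move=> b t ht _; rewrite !val_subZ inordK; last by lia.
  by case/orP: ht => /eqP->.
- move=> d hd; have ltd := ltn_ord d; have [d1|d5] : d = 1 :> nat \/ d = 5 :> nat by lia.
    exists false, (inord 5); rewrite !inordK //; split=> //.
    by apply: ord_inj; rewrite val_subZ !inordK.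
  exists true, (inord 0); rewrite !inordK //; split=> //.
  by apply: ord_inj; rewrite val_subZ !inordK.
- move=> d; rewrite val_oppZ; have := ltn_ord d.
  by case: (eqVneq (d : nat) 0) => [->//|]; lia.
- by move=> f; rewrite -val_eqE val_of_prismF /=; have := ltn_ord f; lia.
- by rewrite val_of_prismT.
- by apply: (four_values _ _ _ _ (fun w => w < 6)).2.
- exact: four_inj.
move=> t; have ltt := ltn_ord t; apply/esym.
apply/forallP/idP => [H|ft]; last first.
  by apply: (four_values _ _ _ _ (fun w => w != t)).2; split; lia.
by have [] := (four_values _ _ _ _ (fun w => w != t)).1 H; lia.
Qed.

(** * Direct constructions for five and nine pairs of letters *)

Section TransversalBase.
Variables (p : nat) (add sub : nat -> nat -> nat) (tab : seq (seq (seq (nat * nat * bool)))).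
Local Notation lt := (nat * bool)%type.

Definition transversal (u : lt * lt * lt) :=
  let: ((i, _), (j, _), (l, _)) := u in [&& ~~ eqn i j, ~~ eqn j l & ~~ eqn i l].

(* The entry of [tab] at [j - i], [l - i] and the three bits gives the position
   and the letter, relative to [i], to be inserted into the triple. *)
Definition insert_tab (u : lt * lt * lt) : lt * lt * lt * lt :=
  let: ((i, x), (j, y), (l, z)) := u in
  let: (k, m, b) := nth (0, 0, false) (nth [::] (nth [::] tab (sub j i)) (sub l i))
    ((if x then 4 else 0) + ((if y then 2 else 0) + (if z then 1 else 0))) in
  let a := (i, x) in let a' := (j, y) in let a'' := (l, z) in let e := (add i m, b) in
  match k with
  | 0 => (e, a, a', a'') | 1 => (a, e, a', a'') | 2 => (a, a', e, a'') | _ => (a, a', a'', e)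
  end.

(** Numbers with [eqn] and [eqb] replace ordinals and generic equality so that [base_ok] can be
    evaluated. *)
Definition word_eqb (w w' : lt * lt * lt * lt) :=
  let: ((i, x), (j, y), (l, z), (m, t)) := w in
  let: ((i', x'), (j', y'), (l', z'), (m', t')) := w' in
  [&& eqn i i', eqn j j', eqn l l', eqn m m', eqb x x', eqb y y', eqb z z' & eqb t t'].

Definition small (u : lt * lt * lt) :=
  let: ((i, _), (j, _), (l, _)) := u in [&& i < p, j < p & l < p].

Definition insert_ok u := ~~ transversal u || let w := insert_tab u in
  all (fun v => [&& small v, transversal v & word_eqb (insert_tab v) w]) (subwords w).

Definition base_ok := all (fun i => all (fun j => all (fun l =>
  all (fun x => all (fun y => all (fun z => insert_ok ((i, x), (j, y), (l, z)))
    [:: true; false]) [:: true; false]) [:: true; false]) (iota 0 p)) (iota 0 p)) (iota 0 p).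

Lemma word_eqbP w w' : word_eqb w w' -> w = w'.
Proof.
case: w w' => [[[[i x] [j y]] [l z]] [m t]] [[[[i' x'] [j' y']] [l' z']] [m' t']].
by case/and5P=> /eqnP-> /eqnP-> /eqnP-> /eqnP-> /and4P[/eqP-> /eqP-> /eqP-> /eqP->].
Qed.

Lemma mem_insert_tab u : u \in subwords (insert_tab u).
Proof.
case: u => [[[i x] [j y]] [l z]]; rewrite /insert_tab.
by case: nth => [[[|[|[|k]]] m] b]; rewrite !inE eqxx ?orbT.
Qed.

Hypotheses (p0 : 0 < p) (ok : base_ok).
Local Notation L := ('I_p * bool)%type.

Let enc (a : L) : lt := (val a.1, a.2).
Let dcd (a : lt) : L := (insubd (Ordinal p0) a.1, a.2).

Lemma base_encK : cancel enc dcd.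
Proof. by case=> i x; rewrite /dcd /enc /= valKd. Qed.

Lemma small_dcdK v : small v -> triple_map enc (triple_map dcd v) = v.
Proof.
case: v => [[[i x] [j y]] [l z]] /and3P[ip jp lp].
by rewrite /= /enc /dcd /= !val_insubd ip jp lp.
Qed.

Lemma base_insert_ok u : insert_ok (triple_map enc u).
Proof.
case: u => [[[i x] [j y]] [l z]]; rewrite /= /enc /=.
have io (i' : 'I_p) : val i' \in iota 0 p by rewrite mem_iota /= ltn_ord.
have bo (b : bool) : b \in [:: true; false] by case: b.
move/allP/(_ _ (io i))/allP/(_ _ (io j))/allP/(_ _ (io l)): ok.
by move/allP/(_ _ (bo x))/allP/(_ _ (bo y))/allP/(_ _ (bo z)).
Qed.

Lemma cov_transversal : cov (fun u : L * L * L => transversal (triple_map enc u)).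
Proof.
exists (fun u => word_map dcd (insert_tab (triple_map enc u))) => u Tu.
have := base_insert_ok u; rewrite /insert_ok Tu /= => /allP okw.
rewrite subwords_map; split.
  by rewrite -{1}(triple_mapK base_encK u) map_f // mem_insert_tab.
move=> _ /mapP[v vw ->]; have /and3P[sv Tv /word_eqbP e] := okw v vw.
by rewrite small_dcdK // Tv e.
Qed.

(** A triple meeting three orbits never lies in a hole of two, so the table covers all of these; the
    remaining triples meet two orbits. *)
Lemma hsys_base : hsys 2 p.
Proof.
pose E (a b : L) := (a.1 != b.1) && ~~ ((a.1 < 2) && (b.1 < 2)).
apply: (cov_split (Q := fun u : L * L * L => transversal (triple_map enc u))).
  apply: eq_cov cov_transversal => - [[[i x] [j y]] [l z]].
  rewrite /= /enc /= -![eqn _ _]/(_ == _) !val_eqE !xpair_eqE [l == i]eq_sym.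
  case: (eqVneq i j) => [|ij]; first by rewrite ?andbF.
  case: (eqVneq j l) => [|jl]; first by rewrite ?andbF.
  case: (eqVneq i l) => [|il]; first by rewrite ?andbF.
  rewrite /= andbT; apply/esym/negP => /and3P[i2 j2 l2].
  by move: ij jl il; rewrite -!val_eqE /=; lia.
apply: (eq_cov _ (cov_two_classes (pi := @flip p) (bit := snd) (E := E) _ _ _ _ _)).
- move=> [[[i x] [j y]] [l z]]; rewrite /two_classes /E /flip /= /enc /=.
  rewrite -![eqn _ _]/(_ == _) !val_eqE !xpair_eqE /= [l == i]eq_sym [l == j]eq_sym.
  case: (eqVneq i j) => [<-|ij].
    case: (eqVneq i l) => [<-|il]; first by case: x y z => [] [] []; rewrite ?andbF.
    by case: (i < 2); case: (l < 2); case: x y z => [] [] [].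
  case: (eqVneq j l) => [<-|jl].
    by case: (i < 2); case: (j < 2); rewrite ?(negPf ij) /=; case: x y z => [] [] [].
  case: (eqVneq i l) => [<-|il]; last by rewrite !andbF.
  by case: (i < 2); case: (j < 2); case: x y z => [] [] [].
- exact: flipK.
- by [].
- by move=> a b; rewrite /E eq_sym [(b.1 < 2) && _]andbC.
- by [].
by move=> a; rewrite /E eqxx.
Qed.
End TransversalBase.

(** By translation invariance only triples with first index 0 are listed; empty lists belong to
    repeated indices. *)
Definition tab5 :=
[::[::[::];
 [::];
 [::];
 [::];
 [::]];
[::[::];
 [::];
 [::(1,4,false);(1,3,false);(0,4,true);(3,3,false);(1,4,true);(3,3,false);(0,4,false);(0,3,true)];
 [::(2,4,false);(1,2,true);(2,2,true);(0,2,true);(2,2,true);(1,2,false);(2,4,false);(0,2,false)];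
 [::(3,3,false);(0,2,true);(1,3,false);(1,2,true);(1,3,true);(0,2,false);(3,3,false);(1,2,false)]];
[::[::];
 [::(2,4,true);(0,3,false);(3,3,true);(3,4,true);(3,3,true);(3,4,true);(2,4,false);(1,3,true)];
 [::];
 [::(0,1,false);(2,4,false);(1,1,true);(2,1,false);(0,1,true);(2,1,false);(1,1,false);(3,4,true)];
 [::(3,3,true);(3,1,false);(0,3,false);(2,1,true);(0,3,true);(2,1,true);(3,1,false);(2,3,true)]];
[::[::];
 [::(3,2,true);(3,4,false);(0,2,false);(2,4,true);(0,2,true);(2,4,true);(3,4,false);(2,2,true)];
 [::(0,4,false);(2,1,false);(1,4,true);(2,4,false);(0,4,true);(2,4,false);(1,4,false);(3,1,true)];
 [::];
 [::(2,1,true);(0,2,false);(3,2,true);(3,1,true);(3,2,true);(3,1,true);(2,1,false);(1,2,true)]];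
[::[::];
 [::(3,2,false);(0,3,true);(1,2,false);(1,3,true);(1,2,true);(0,3,false);(3,2,false);(1,3,false)];
 [::(2,1,false);(1,3,true);(2,3,true);(0,3,true);(2,3,true);(1,3,false);(2,1,false);(0,3,false)];
 [::(1,1,false);(1,2,false);(0,1,true);(3,2,false);(1,1,true);(3,2,false);(0,1,false);(0,2,true)];
 [::]]].

Definition tab9 :=
[::[::[::];
 [::];
 [::];
 [::];
 [::];
 [::];
 [::];
 [::];
 [::]];
[::[::];
 [::];
 [::(0,7,true);(3,8,true);(0,3,false);(1,6,false);(2,3,true);(3,8,false);(2,5,true);(0,3,true)];
 [::(2,5,true);(3,6,true);(0,7,false);(0,8,false);(3,7,true);(3,2,false);(1,6,false);(0,4,false)];
 [::(2,5,false);(3,7,false);(0,8,true);(1,2,false);(2,5,true);(0,6,true);(1,2,false);(3,7,true)];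
 [::(3,4,false);(3,3,false);(1,4,false);(2,8,true);(3,6,false);(3,4,false);(0,7,true);(3,2,false)];
 [::(1,4,false);(2,3,true);(1,5,false);(1,7,true);(2,5,false);(1,8,true);(1,4,false);(1,5,true)];
 [::(2,4,true);(0,8,true);(0,2,true);(0,2,false);(1,4,false);(2,3,false);(3,8,true);(2,4,true)];
 [::(0,7,false);(2,2,true);(0,7,true);(3,5,true);(2,2,true);(1,6,false);(1,4,true);(2,7,false)]];
[::[::];
 [::(0,5,true);(3,4,true);(0,6,false);(1,3,false);(2,6,true);(3,4,false);(2,7,true);(0,6,true)];
 [::];
 [::(1,8,false);(2,6,true);(1,7,false);(1,5,true);(2,7,false);(1,4,true);(1,8,false);(1,7,true)];
 [::(0,5,false);(2,1,true);(0,5,true);(3,7,true);(2,1,true);(1,3,false);(1,8,true);(2,5,false)];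
 [::(2,8,true);(0,4,true);(0,1,true);(0,1,false);(1,8,false);(2,6,false);(3,4,true);(2,8,true)];
 [::(2,7,true);(3,3,true);(0,5,false);(0,4,false);(3,5,true);(3,1,false);(1,3,false);(0,8,false)];
 [::(3,8,false);(3,6,false);(1,8,false);(2,4,true);(3,3,false);(3,8,false);(0,5,true);(3,1,false)];
 [::(2,7,false);(3,5,false);(0,4,true);(1,1,false);(2,7,true);(0,3,true);(1,1,false);(3,5,true)]];
[::[::];
 [::(1,5,false);(2,2,true);(1,8,false);(1,4,true);(2,8,false);(1,7,true);(1,5,false);(1,8,true)];
 [::(2,8,true);(3,1,true);(0,4,false);(0,7,false);(3,4,true);(3,6,false);(1,1,false);(0,5,false)];
 [::];
 [::(2,5,true);(0,7,true);(0,6,true);(0,6,false);(1,5,false);(2,2,false);(3,7,true);(2,5,true)];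
 [::(2,8,false);(3,4,false);(0,7,true);(1,6,false);(2,8,true);(0,1,true);(1,6,false);(3,4,true)];
 [::(0,4,true);(3,7,true);(0,2,false);(1,1,false);(2,2,true);(3,7,false);(2,8,true);(0,2,true)];
 [::(0,4,false);(2,6,true);(0,4,true);(3,8,true);(2,6,true);(1,1,false);(1,5,true);(2,4,false)];
 [::(3,5,false);(3,2,false);(1,5,false);(2,7,true);(3,1,false);(3,5,false);(0,4,true);(3,6,false)]];
[::[::];
 [::(3,6,false);(3,5,false);(1,6,false);(2,3,true);(3,7,false);(3,6,false);(0,2,true);(3,8,false)];
 [::(2,6,true);(0,3,true);(0,8,true);(0,8,false);(1,6,false);(2,5,false);(3,3,true);(2,6,true)];
 [::(0,2,false);(2,8,true);(0,2,true);(3,1,true);(2,8,true);(1,7,false);(1,6,true);(2,2,false)];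
 [::];
 [::(2,1,true);(3,7,true);(0,2,false);(0,3,false);(3,2,true);(3,8,false);(1,7,false);(0,6,false)];
 [::(2,1,false);(3,2,false);(0,3,true);(1,8,false);(2,1,true);(0,7,true);(1,8,false);(3,2,true)];
 [::(1,6,false);(2,5,true);(1,1,false);(1,2,true);(2,1,false);(1,3,true);(1,6,false);(1,1,true)];
 [::(0,2,true);(3,3,true);(0,5,false);(1,7,false);(2,5,true);(3,3,false);(2,1,true);(0,5,true)]];
[::[::];
 [::(2,3,false);(3,6,false);(0,2,true);(1,7,false);(2,3,true);(0,4,true);(1,7,false);(3,6,true)];
 [::(0,6,false);(2,7,true);(0,6,true);(3,3,true);(2,7,true);(1,4,false);(1,1,true);(2,6,false)];
 [::(3,1,false);(3,8,false);(1,1,false);(2,2,true);(3,4,false);(3,1,false);(0,6,true);(3,7,false)];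
 [::(1,1,false);(2,8,true);(1,3,false);(1,6,true);(2,3,false);(1,2,true);(1,1,false);(1,3,true)];
 [::];
 [::(2,1,true);(0,2,true);(0,7,true);(0,7,false);(1,1,false);(2,8,false);(3,2,true);(2,1,true)];
 [::(0,6,true);(3,2,true);(0,8,false);(1,4,false);(2,8,true);(3,2,false);(2,3,true);(0,8,true)];
 [::(2,3,true);(3,4,true);(0,6,false);(0,2,false);(3,6,true);(3,7,false);(1,4,false);(0,1,false)]];
[::[::];
 [::(2,4,true);(3,2,true);(0,8,false);(0,5,false);(3,8,true);(3,3,false);(1,2,false);(0,7,false)];
 [::(1,7,false);(2,1,true);(1,4,false);(1,8,true);(2,4,false);(1,5,true);(1,7,false);(1,4,true)];
 [::(0,8,true);(3,5,true);(0,1,false);(1,2,false);(2,1,true);(3,5,false);(2,4,true);(0,1,true)];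
 [::(3,7,false);(3,1,false);(1,7,false);(2,5,true);(3,2,false);(3,7,false);(0,8,true);(3,3,false)];
 [::(0,8,false);(2,3,true);(0,8,true);(3,4,true);(2,3,true);(1,2,false);(1,7,true);(2,8,false)];
 [::];
 [::(2,4,false);(3,8,false);(0,5,true);(1,3,false);(2,4,true);(0,2,true);(1,3,false);(3,8,true)];
 [::(2,7,true);(0,5,true);(0,3,true);(0,3,false);(1,7,false);(2,1,false);(3,5,true);(2,7,true)]];
[::[::];
 [::(0,3,false);(2,5,true);(0,3,true);(3,6,true);(2,5,true);(1,8,false);(1,2,true);(2,3,false)];
 [::(2,6,false);(3,3,false);(0,1,true);(1,5,false);(2,6,true);(0,8,true);(1,5,false);(3,3,true)];
 [::(2,2,true);(0,1,true);(0,5,true);(0,5,false);(1,2,false);(2,4,false);(3,1,true);(2,2,true)];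
 [::(2,6,true);(3,8,true);(0,3,false);(0,1,false);(3,3,true);(3,5,false);(1,8,false);(0,2,false)];
 [::(0,3,true);(3,1,true);(0,4,false);(1,8,false);(2,4,true);(3,1,false);(2,6,true);(0,4,true)];
 [::(3,2,false);(3,4,false);(1,2,false);(2,1,true);(3,8,false);(3,2,false);(0,3,true);(3,5,false)];
 [::];
 [::(1,2,false);(2,4,true);(1,6,false);(1,3,true);(2,6,false);(1,1,true);(1,2,false);(1,6,true)]];
[::[::];
 [::(2,3,true);(0,6,true);(0,4,true);(0,4,false);(1,3,false);(2,7,false);(3,6,true);(2,3,true)];
 [::(3,3,false);(3,7,false);(1,3,false);(2,6,true);(3,5,false);(3,3,false);(0,1,true);(3,4,false)];
 [::(2,2,false);(3,1,false);(0,6,true);(1,4,false);(2,2,true);(0,5,true);(1,4,false);(3,1,true)];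
 [::(0,1,true);(3,6,true);(0,7,false);(1,5,false);(2,7,true);(3,6,false);(2,2,true);(0,7,true)];
 [::(1,3,false);(2,7,true);(1,2,false);(1,1,true);(2,2,false);(1,6,true);(1,3,false);(1,2,true)];
 [::(0,1,false);(2,4,true);(0,1,true);(3,2,true);(2,4,true);(1,5,false);(1,3,true);(2,1,false)];
 [::(2,2,true);(3,5,true);(0,1,false);(0,6,false);(3,1,true);(3,4,false);(1,5,false);(0,3,false)];
 [::]]].

Definition mod_add m i j := if i + j < m then i + j else i + j - m.
Definition mod_sub m i j := if j <= i then i - j else i + m - j.
Definition split9 i := if i < 3 then (0, i) else if i < 6 then (1, i - 3) else (2, i - 6).
(* Indices below 9 are read in base 3 as elements of the field with 9 elements. *)
Definition op9 (op : nat -> nat -> nat) i j :=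
  let: (a, b) := split9 i in let: (c, d) := split9 j in 3 * op a c + op b d.

Lemma hsys_five : hsys 2 5.
Proof. by apply: (@hsys_base 5 (mod_add 5) (mod_sub 5) tab5) => //; vm_compute. Qed.

Lemma hsys_nine : hsys 2 9.
Proof.
by apply: (@hsys_base 9 (op9 (mod_add 3)) (op9 (mod_sub 3)) tab9) => //; vm_compute.
Qed.

(** * Induction on the number of pairs, and the theorem *)

Lemma hsys_one : hsys 0 1.
Proof.
apply: cov0 => - [[[i x] [j y]] [l z]]; rewrite !ord1 /=.
by case: x y z => [] [] [].
Qed.

Lemma hsys_triple2 n : 1 < n -> ~~ odd n -> hsys 2 n.+1 -> hsys 0 n.+1 -> hsys 2 (3 * n.+1).
Proof.
move=> n1 en; pose Hs : seq 'I_n.*2.+2 := [:: inord 0; inord 1; inord n.+1; inord n.+2].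
have HsE (x : 'I_n.*2.+2) : (x \in Hs) =
    [|| x == 0 :> nat, x == 1 :> nat, x == n.+1 :> nat | x == n.+2 :> nat].
  by rewrite !inE -!val_eqE /= !inordK //; lia.
apply: (hsys_triple en (Hs := Hs)) => //.
  by rewrite /= !inE -!val_eqE /= !inordK //; lia.
move=> x; have ltx := ltn_ord x; rewrite !HsE val_addZ val_antipode.
by case: (ltnP (x + n.+1) n.*2.+2); lia.
Qed.

(** The cases 5 and 9 are direct because the recursions for 3k + 2 and 3k would call for [hsys 2 3],
    which the induction does not supply. *)
Lemma hsys_exists n : 0 < n -> hsys 0 n /\ (n != 1 -> n != 3 -> hsys 2 n).
Proof.
elim/ltn_ind: n => n IH n0.
case: (eqVneq n 1) => [->|n1]; first by split=> //; apply: hsys_one.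
case: (eqVneq n 3) => [->|n3].
  by split=> //; apply: (@hsys_triple 0 _ 0 [::]) => //; apply: hsys_one.
suff sys : hsys 2 n by split; [apply: hsys20 | ].
have IH0 m : 0 < m < n -> hsys 0 m by case/andP=> m0 mn; case: (IH m mn m0).
have IH2 m : 0 < m < n -> m != 1 -> m != 3 -> hsys 2 m.
  by case/andP=> m0 mn; case: (IH m mn m0).
case on: (odd n); last first.
  have -> : n = n./2.-1.+1.*2 by lia.
  by apply: hsys_double; apply: IH0; lia.
pose i := n %/ 6; have ni : n = 6 * i + n %% 6 by rewrite mulnC -divn_eq.
have : n %% 6 < 6 by rewrite ltn_mod.
have [r1|[r3|r5]] : n %% 6 = 1 \/ n %% 6 = 3 \/ n %% 6 = 5 by lia.
- have -> : n = (3 * i.-1.*2.+2).+1 by lia.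
  by move=> _; apply: hsys_even; apply: IH0; lia.
- move=> _; case: (eqVneq i 1) => i1.
    by have -> : n = 9 by [lia]; apply: hsys_nine.
  have -> : n = 3 * i.*2.+1 by lia.
  by apply: hsys_triple2; [lia | rewrite odd_double | apply: IH2; lia | apply: IH0; lia].
move=> _; case: (eqVneq i 0) => i0; first by have -> : n = 5 by [lia]; apply: hsys_five.
case: (eqVneq i 1) => i1.
  by have -> : n = 11 by [lia]; apply/hsys_eleven/hsys_five.
have -> : n = (3 * i.*2.+1).+2 by lia.
by apply: hsys_odd; [lia | apply: IH2; lia].
Qed.

Theorem theorem4p4 (q : nat) : 2 <= q -> ~~ odd q ->
  N1 4 q = (q ^ 2 * (q + 2)) %/ 4.
Proof.
move=> q2 eq; apply/eqP; rewrite eqn_leq; apply/andP; split.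
  apply/bigmax_leqP => C HC; rewrite leq_divRL // mulnC.
  exact: del_code_bound.
(* The involution [a <-> q - 1 - a] has no fixed point, [q - 1] being odd. *)
have rK := @rev_ordK q.
have rN (a : 'I_q) : rev_ord a != a.
  by rewrite -val_eqE /=; have := ltn_ord a; lia.
have [|sys _] := @hsys_exists q./2; first by lia.
have [|C HC cC] := code_of_system rK rN.
  apply: (hsysE (n := q./2) (h := 0) rK rN _ _ _).2 => //.
    by rewrite card_ord; lia.
  exact: eq_card0.
apply: leq_trans (leq_bigmax_cond _ HC).
by rewrite -[X in _ <= X](mulKn _ (isT : 0 < 4)) leq_div2r.
Qed.
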